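(* Let $\psi:\mathbb{R}\to\mathbb{R}_+$ be a convex function of the form $\psi(u)=u^{\varkappa}\theta(u)$ for $u>0$, with $\varkappa\in[1,2)$, where $\theta$ is slowly varying at zero and admits, for $u\in(0,1)$, the Karamata representation $$\theta(u)=c(u)\exp\left(\int_u^1\frac{\varepsilon(v)}{v}\,\mathrm{d}v\right),$$ where $c(\cdot)$ is a positive bounded measurable function with a nonzero limit at zero and $\varepsilon(\cdot)$ is a bounded measurable function with zero limit at zero. Assume further that there exists $\alpha\in(0,1)$ such that, for all sufficiently small $v>0$, $$\varepsilon(v)>-\frac{1}{|\log v|^{\alpha}}.$$ Then, for any $r>0$, almost surely $$\frac{2^{-\varkappa/2}}{1-\varkappa/2}\ \ge\ \limsup_{T\to\infty}\frac{I_W^{\psi}(T,r)}{T\,\psi\left(\sqrt{\frac{\log\log T}{T}}\right)}\ \ge\ 2^{\varkappa/2}.$$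
   Context: $W(\cdot)$ is a standard Wiener process on $[0,\infty)$ with $W(0)=0$. $AC[0,T]$ is the space of absolutely continuous functions on $[0,T]$. $\mathbb{R}_+=[0,\infty)$. For convex $\psi:\mathbb{R}\to\mathbb{R}_+$ and $h\in AC[0,T]$, $|h|_T^{\psi}:=\int_0^T\psi(h'(t))\,\mathrm{d}t$. For $T,r>0$, $I_W^{\psi}(T,r):=\inf\{|h|_T^{\psi}: h\in AC[0,T],\ h(0)=r,\ h(t)\ge W(t)\ \text{for all } t\in[0,T]\}$ (a random variable; equivalently one may require $h(0)=0$ and $h\ge W-r$). *)

(* Defs.v *)
From HB Require Import structures.
From mathcomp Require Import all_boot all_order all_algebra.
From mathcomp Require Import all_classical all_reals all_analysis.

Set Implicit Arguments.
Unset Strict Implicit.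
Unset Printing Implicit Defensive.

Import Order.TTheory GRing.Theory Num.Theory.
Import numFieldNormedType.Exports.

Local Open Scope classical_set_scope.
Local Open Scope ring_scope.

Definition abs_continuous (R : realType) (a b : R) (f : R -> R) : Prop :=
  forall e : R, 0 < e -> exists2 d : R, 0 < d &
    forall (n : nat) (x y : 'I_n -> R),
      (forall i, [/\ a <= x i, x i <= y i & y i <= b]) ->
      trivIset [set: 'I_n] (fun i => `]x i, y i[%classic) ->
      \sum_(i < n) (y i - x i) < d ->
      \sum_(i < n) `|f (y i) - f (x i)| < e.

(* [derive1 h] is total, with a fixed default value where [h] is not
   differentiable; for [h] absolutely continuous on [[0, T]] this concerns only
   a null set.  The domain is the open interval because [derive1 h] is
   two-sided and the values of [h] outside [[0, T]] are irrelevant. *)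
Definition psi_energy (R : realType) (psi : R -> R) (T : R) (h : R -> R)
    : \bar R :=
  (\int[@lebesgue_measure R]_(t in `]0%R, T[) (psi (derive1 h t))%:E)%E.

Definition min_energy (R : realType) (psi : R -> R) (w : R -> R) (T r : R)
    : \bar R :=
  ereal_inf [set psi_energy psi T h | h in
    [set h : R -> R | [/\ abs_continuous 0 T h, h 0 = r &
                          forall t : R, 0 <= t <= T -> w t <= h t]]].

Definition mutually_independent (R : realType) (d : measure_display)
    (Omega : measurableType d) (P : probability Omega R) (n : nat)
    (X : 'I_n -> Omega -> R) : Prop :=
  forall (J : {set 'I_n}) (A : 'I_n -> set R), (forall i, measurable (A i)) ->
    P (\bigcap_(i in [set` J]) X i @^-1` A i) =
    (\prod_(i in J) P (X i @^-1` A i))%E.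

(* A process indexed by [[0, +oo[]: the variables [W t] with [t < 0] play no
   role.  [normal_prob] takes the mean and the standard deviation. *)
Record standard_wiener (R : realType) (d : measure_display)
    (Omega : measurableType d) (P : probability Omega R)
    (W : R -> {RV P >-> R}) : Prop := StandardWiener {
  wiener_start : {ae P, forall w, W 0 w = 0} ;
  wiener_independent_increments :
    forall (n : nat) (t : nat -> R), 0 <= t 0%N ->
      {homo t : i j / (i <= j)%N >-> i <= j} ->
      mutually_independent P
        (fun (i : 'I_n) (w : Omega) => W (t i.+1) w - W (t i) w) ;
  wiener_gaussian_increments :
    forall s t : R, 0 <= s -> s < t ->
      forall A : set R, measurable A ->
        P [set w | A (W t w - W s w)] = normal_prob 0 (Num.sqrt (t - s)) A ;
  wiener_continuous_paths :
    {ae P, forall w, {within `[0, +oo[, continuous (fun t => W t w)}} }.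

Definition slowly_varying_at0 (R : realType) (theta : R -> R) : Prop :=
  (exists2 a : R, 0 < a &
     measurable_fun (`]0, a[ : set R) theta /\
     forall u : R, 0 < u < a -> 0 < theta u) /\
  (forall l : R, 0 < l -> theta (l * u) / theta u @[u --> 0^'+] --> (1 : R)).

Record karamata_representation (R : realType) (theta c eps : R -> R) : Prop :=
  KaramataRepresentation {
  karamata_c_gt0 : forall u : R, 0 < u < 1 -> 0 < c u ;
  karamata_c_bounded : exists M : R, forall u : R, 0 < u < 1 -> `|c u| <= M ;
  karamata_c_measurable : measurable_fun (`]0, 1[ : set R) c ;
  karamata_c_limit : exists2 l : R, l != 0 & c u @[u --> 0^'+] --> l ;
  karamata_eps_bounded : exists M : R, forall v : R, 0 < v < 1 -> `|eps v| <= M ;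
  karamata_eps_measurable : measurable_fun (`]0, 1[ : set R) eps ;
  karamata_eps_limit : eps v @[v --> 0^'+] --> (0 : R) ;
  karamata_eq : forall u : R, 0 < u < 1 ->
    theta u =
    c u * expR (\int[@lebesgue_measure R]_(v in `]u, 1[) (eps v / v)) }.

(* Main.v *)
(* By Jensen's inequality an absolutely continuous [h] on [[0, T]] has energy at
   least [T psi ((h T - h 0) / T)].  A majorant of [w] starting at [r] has
   [h T >= w T], and along the times where the Wiener path reaches
   [(1 - e) sqrt (2 T log log T)] the mean slope is at least
   [(1 - 2e) sqrt 2 * u], with [u := sqrt (log log T / T)]; regular variation of
   [psi] turns this into [2^(kappa/2) psi u].

   Conversely, the path is eventually below [B t = (1 + e) sqrt (2 t log log t)],
   so a line up to a large fixed time followed by a translate of [B] is an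
   admissible [h], and the initial segment costs a constant, which is negligible.
   The slope of [B] at [s] is close to [sqrt (log log s / s) / sqrt 2].  A Potter
   bound, [psi (lambda u) <= C lambda^p psi u] with [p > kappa] close to [kappa]
   and [C] close to [1], bounds the energy density at [s] by about
   [2^(-kappa/2) (T/s)^(p/2) psi u], whose integral over [[0, T]] gives
   [2^(-kappa/2) / (1 - p/2) * T psi u].

   Both halves of the law of the iterated logarithm are derived from Gaussian
   tails along geometric times: the upper one with dyadic chaining inside each
   block, the lower one with the second Borel-Cantelli lemma for the independent
   increments. *)

Require Import Defs.
From HB Require Import structures.
From mathcomp Require Import all_boot all_order all_algebra.
From mathcomp Require Import all_classical all_reals all_analysis.
From mathcomp Require Import measurable_realfun ring lra.

Set Implicit Arguments.
Unset Strict Implicit.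
Unset Printing Implicit Defensive.

Import Order.TTheory GRing.Theory Num.Theory.
Import numFieldNormedType.Exports.

Local Open Scope classical_set_scope.
Local Open Scope ring_scope.

(** Since [psi (derive1 h t)] need not be known to be measurable, an energy is a supremum of
    integrals of simple functions below the integrand, and it can only be compared pointwise with
    measurable functions. Every exceptional point therefore has to be covered explicitly: the null
    set where [derive1 h] misses the density, and the kink of the explicit majorant.

    Jensen's inequality needs [h T - h 0] as the integral of [derive1 h]. Absolute continuity
    controls finite families of intervals only, so [h] is split into two monotone functions and
    their Stieltjes measures are shown to be dominated by Lebesgue measure.

    Ratio limits for [psi] are given for one factor at a time, whereas the energy density needs them
    uniformly in the factor. Convexity closes this gap: it forces [psi 0 = 0], hence monotonicity,
    and a single ratio can then be iterated. Because [p < 2], the normalization grows at least like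
    T^(1 - p/2), which is what makes the cost of the initial segment disappear. *)

(* Monotonicity with no measurability assumption: nothing is known about the
   measurability of [psi \o derive1 h]. *)
Lemma ge0_lower_integral_le d (T : measurableType d) (R : realType)
    (mu : {measure set T -> \bar R}) (D : set T) (f g : T -> \bar R) :
  (forall x, D x -> 0 <= f x)%E -> (forall x, D x -> f x <= g x)%E ->
  (\int[mu]_(x in D) f x <= \int[mu]_(x in D) g x)%E.
Proof.
move=> f0 fg.
have g0 x : D x -> (0 <= g x)%E by move=> Dx; apply: le_trans (fg _ Dx); exact: f0.
rewrite !ge0_integralE//; apply: le_ereal_sup => _ [h /= hf <-].
exists h => //= x; apply: (le_trans (hf x)).
by apply: lee_restrict.
Qed.

(** * Absolutely continuous functions *)

Section absolute_continuity.
Context {R : realType}.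
Implicit Types (a b : R) (f : R -> R) (I J : R * R) (L : seq (R * R)).

Definition apart I J := (I.2 <= J.1) || (J.2 <= I.1).

Lemma apart_sym I J : apart I J = apart J I.
Proof. by rewrite /apart orbC. Qed.

Definition subitv a b I := [&& a <= I.1, I.1 <= I.2 & I.2 <= b].

(** Lists replace indexed families so that an interval can be exchanged for the pieces of a
    partition by concatenation. The final inequality is weak so that it survives suprema over
    partitions. *)
Definition ac_family a b f := forall e : R, 0 < e -> exists2 d : R, 0 < d &
  forall L, all (subitv a b) L -> pairwise apart L ->
    \sum_(I <- L) (I.2 - I.1) < d -> \sum_(I <- L) `|f I.2 - f I.1| <= e.

Lemma abs_continuous_family a b f : abs_continuous a b f -> ac_family a b f.
Proof.
move=> acf e e0; have [d d0 H] := acf e e0; exists d => // L /allP Lab apL Ld.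
pose x (i : 'I_(size L)) := (nth (0, 0) L i).1.
pose y (i : 'I_(size L)) := (nth (0, 0) L i).2.
have sE (F : R -> R -> R) :
    \sum_(I <- L) F I.1 I.2 = \sum_(i < size L) F (x i) (y i).
  by rewrite (big_nth (0, 0)) big_mkord.
rewrite (sE (fun u v => `|f v - f u|)); apply/ltW/H.
- by move=> i; apply/and3P; apply: Lab; exact: mem_nth.
- apply/trivIsetP => i j _ _ ij.
  wlog {ij} ij : i j / (i < j)%N => [W|].
    move: ij; rewrite neq_ltn => /orP[|]; first exact: W.
    by rewrite setIC; exact: W.
  have := pairwiseP (0, 0) apL i j (ltn_ord i) (ltn_ord j) ij.
  rewrite /apart -/(x i) -/(y i) -/(x j) -/(y j) => H1.
  apply/seteqP; split => // z /= [].
  rewrite !in_itv/= => /andP[z1 z2] /andP[z3 z4].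
  by case/orP : H1 => ?; lra.
- by rewrite -(sE (fun u v => v - u)).
Qed.

Lemma itv_partition_pieces a b (s : seq R) : itv_partition a b s ->
  let L := [seq (z.2, z.1) | z <- zip s (a :: s)] in
  [/\ all (subitv a b) L, pairwise apart L & \sum_(I <- L) (I.2 - I.1) = b - a].
Proof.
elim: s a => [a|h t ih a] sp /=.
  by rewrite big_nil (itv_partition_nil sp) subrr.
have ah : a < h by case: sp => /= /andP[].
have hb := itv_partition_le (itv_partition_cons sp).
have [/allP H1 H2 H3] := ih h (itv_partition_cons sp); split.
- rewrite /subitv /= lexx (ltW ah) hb/=; apply/allP => I /H1 /and3P[h1 h2 h3].
  by apply/and3P; split => //; rewrite (le_trans _ h1)// ltW.
- rewrite H2 andbT; apply/allP => I /H1 /and3P[h1 h2 h3].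
  by rewrite /apart/= h1.
- by rewrite big_cons H3/= addrC addrA subrK.
Qed.

(** Cutting each interval of an admissible family gives an admissible family of the same total
    length, so the same [d] controls the suprema over all cuts. *)
Lemma ac_family_TV a b f : ac_family a b f ->
  forall e : R, 0 < e -> exists2 d : R, 0 < d &
  forall L, all (subitv a b) L -> pairwise apart L ->
    \sum_(I <- L) (I.2 - I.1) < d ->
    (\sum_(I <- L) total_variation I.1 I.2 f <= e%:E)%E.
Proof.
move=> acf e e0; have [d d0 H] := acf e e0; exists d => // L.
(* [L1] collects the pieces of the intervals already cut; this allows the supremum over partitions
   to be taken for one interval at a time. *)
suff gen L1 : all (subitv a b) (L1 ++ L) -> pairwise apart (L1 ++ L) ->
    \sum_(I <- L1 ++ L) (I.2 - I.1) < d ->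
    ((\sum_(I <- L1) `|f I.2 - f I.1|)%:E +
     \sum_(I <- L) total_variation I.1 I.2 f <= e%:E)%E.
  by move=> h1 h2 h3; have := gen [::] h1 h2 h3; rewrite big_nil add0e.
elim: L L1 => [L1|I L ih L1].
  rewrite cats0 big_nil adde0 => h1 h2 h3; rewrite lee_fin; exact: H.
set X := \sum_(J <- L1) _; set Y := (\sum_(J <- L) _)%E in ih *.
rewrite !all_cat !pairwise_cat /= allrel_consr !big_cat /= !big_cons.
move=> /and3P[L1ab /and3P[aI1 I12 I2b] Lab].
move=> /and3P[/andP[L1I L1L] apL1 /andP[IL apL]] dL.
have Ipieces s : itv_partition I.1 I.2 s ->
    ((X + variation I.1 I.2 f s)%:E + Y <= e%:E)%E.
  move=> sp; have [/allP h1 h2 h3] := itv_partition_pieces sp.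
  set P := [seq _ | _ <- _] in h1 h2 h3.
  have apP J : apart J I -> all (apart J) P.
    move=> JI; apply/allP => K /h1 /and3P[k1 k2 k3].
    move: JI; rewrite /apart => /orP[JI|JI]; apply/orP; [left|right]; lra.
  have -> : variation I.1 I.2 f s = \sum_(J <- P) `|f J.2 - f J.1|.
    by rewrite (variation_zip _ sp) big_map.
  have := ih (L1 ++ P); rewrite !all_cat !pairwise_cat !big_cat /=.
  apply.
  - rewrite L1ab Lab andbT; apply/allP => J /h1 /and3P[j1 j2 j3].
    by apply/and3P; split; lra.
  - rewrite allrel_catl apL1 apL h2 L1L /= andbT; apply/andP; split.
      apply/allrelP => K J KP JL.
      have IJ := allP IL _ JL; have := apP J; rewrite apart_sym => /(_ IJ)/allP.
      by rewrite apart_sym => /(_ _ KP).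
    rewrite ?andbT; apply/allrelP => J K JL1 KP.
    by have /allP := apP J (allP L1I _ JL1); exact.
  - by rewrite h3 -addrA.
have Y0 : (0 <= Y)%E.
  rewrite /Y big_seq; apply: sume_ge0 => J /(allP Lab) /and3P[_ ? _].
  exact: total_variation_ge0.
(* A single partition suffices to see that [Y] is finite, which is needed to move it across the
   inequality before taking the supremum. *)
have [s sp] : exists s, itv_partition I.1 I.2 s.
  move: I12; rewrite le_eqVlt => /predU1P[->|I12]; first by exists [::]; split=> //=.
  by exists [:: I.2]; exact: itv_partition1.
have Yfin : Y \is a fin_num.
  rewrite ge0_fin_numE// ltNge leye_eq; apply/negP => /eqP Yoo.
  by have := Ipieces _ sp; rewrite Yoo addey// leye_eq.
rewrite addeCA -leeBrDr//; last by rewrite fin_numD Yfin.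
apply: ge_ereal_sup => _ /= [_ [t tp <-] <-].
rewrite leeBrDr; last by rewrite fin_numD Yfin.
by rewrite addeA -EFinD (addrC (variation _ _ _ _)); exact: Ipieces.
Qed.

End absolute_continuity.

(** * Dyadic cells and the exhaustion of open sets *)

Section dyadic_cells.
Context {R : realType}.
Variables (a b : R).
Hypothesis ab : a < b.

Definition dyadic n k : R := a + (b - a) * (k%:R / 2 ^+ n).
(** Half-open as in the semiring generating a Stieltjes measure, so that the cells of one level tile
    []a, b]] exactly. *)
Definition cell n k : set R := `]dyadic n k, dyadic n k.+1]%classic.

Lemma dyadic_le n k l : (k <= l)%N -> dyadic n k <= dyadic n l.
Proof.
move=> kl; rewrite /dyadic lerD2l ler_pM2l ?subr_gt0//.
by rewrite ler_pM2r ?invr_gt0 ?exprn_gt0// ler_nat.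
Qed.

Lemma dyadicS n k : dyadic n.+1 k.*2 = dyadic n k.
Proof.
rewrite /dyadic -muln2 natrM exprS; congr (_ + _ * _).
have : (2 ^+ n : R) != 0 by rewrite expf_neq0.
by move=> ?; field.
Qed.

Lemma dyadic0 n : dyadic n 0 = a.
Proof. by rewrite /dyadic mul0r mulr0 addr0. Qed.

Lemma dyadic_max n : dyadic n (2 ^ n) = b.
Proof. by rewrite /dyadic natrX divff ?expf_neq0// mulr1 addrC subrK. Qed.

Lemma trivIset_cell n : trivIset setT (cell n).
Proof.
apply/trivIsetP => i j _ _.
wlog: i j / (i < j)%N => [W|ij _].
  rewrite neq_ltn => /orP[|] h; first by apply: W => //; rewrite ltn_eqF.
  by rewrite setIC; apply: W => //; rewrite ltn_eqF.
apply/seteqP; split => // z; rewrite /cell /= => -[]; rewrite !in_itv/= => /andP[_ h1] /andP[h2 _].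
by have := dyadic_le n ij; rewrite leNgt (lt_le_trans h2 h1).
Qed.

Lemma cellS n k x : cell n k x ->
  exists2 l, (l = k.*2 \/ l = k.*2.+1) & cell n.+1 l x.
Proof.
rewrite /cell /= !in_itv/= -dyadicS -(dyadicS n k.+1) => /andP[h1 h2].
have [h|h] := leP x (dyadic n.+1 k.*2.+1).
  by exists k.*2; [left|rewrite /= in_itv/= h1 h].
by exists k.*2.+1; [right|rewrite /= in_itv/= h].
Qed.

Lemma cellSsub n k l : (l = k.*2 \/ l = k.*2.+1) -> cell n.+1 l `<=` cell n k.
Proof.
move=> lk x; rewrite /cell /= !in_itv/= => /andP[h1 h2].
rewrite -dyadicS -(dyadicS n k.+1).
have k1 : (k.*2 <= l)%N by case: lk => ->.
have k2 : (l.+1 <= k.+1.*2)%N by case: lk => ->; rewrite ?doubleS.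
by rewrite (le_lt_trans (dyadic_le _ k1))//= (le_trans _ (dyadic_le _ k2)).
Qed.

Lemma ex_cell n x : a < x <= b -> exists2 k, (k < 2 ^ n)%N & cell n k x.
Proof.
move=> /andP[ax xb].
have ex : exists k, x <= dyadic n k by exists (2 ^ n)%N; rewrite dyadic_max.
case: (ex_minnP ex) => -[|k]; first by rewrite dyadic0 leNgt ax.
move=> kx kmin; exists k; first by apply: kmin; rewrite dyadic_max.
rewrite /cell /= in_itv/= kx andbT ltNge; apply/negP => /kmin.
by rewrite ltnn.
Qed.

(* An open set is the increasing union of the finite families of the dyadic
   cells it contains; this transfers absolute continuity from finite families of
   intervals to null sets. *)
Definition inner n (U : set R) :=
  [seq k <- iota 0 (2 ^ n) | `[< cell n k `<=` U >]].

Lemma mem_inner n U k : k \in inner n U = (k < 2 ^ n)%N && `[< cell n k `<=` U >].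
Proof. by rewrite mem_filter mem_iota add0n andbC. Qed.

Definition inner_cells U n := \bigcup_(k in [set` inner n U]) cell n k.

Lemma inner_cells_sub U n : inner_cells U n `<=` U.
Proof. by move=> x [k /=]; rewrite mem_inner => /andP[_ /asboolP]; apply. Qed.

Lemma measurable_inner_cells U n : measurable (inner_cells U n).
Proof. by apply: bigcup_measurable => k _; exact: measurable_itv. Qed.

Lemma inner_cells_nd U : {homo inner_cells U : n m / (n <= m)%N >-> (n <= m)%O}.
Proof.
apply: homo_leq => //=; first by move=> x y z; exact: le_trans.
move=> n; apply/subsetPset => x [k /=]; rewrite mem_inner => /andP[k2 /asboolP kU] kx.
have [l lk lx] := cellS kx; exists l => //=; rewrite mem_inner; apply/andP; split.
  rewrite expnS mul2n; case: lk => ->; first by rewrite ltn_double.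
  by rewrite -doubleS ltn_Sdouble -?doubleS ?leq_double// .
by apply/asboolP; apply: subset_trans (cellSsub lk) kU.
Qed.

Lemma bigcup_inner_cells U : open U -> U `&` `]a, b] `<=` \bigcup_n inner_cells U n.
Proof.
move=> oU x [Ux]; rewrite /= in_itv/= => axb.
have : nbhs x U by exact: open_nbhs_nbhs.
rewrite -filter_from_ballE => -[e /= e0 eU].
have ba0 : 0 < b - a by rewrite subr_gt0.
near \oo => n.
have ne : (b - a) / 2 ^+ n < e.
  rewrite ltr_pdivrMr ?exprn_gt0// mulrC -ltr_pdivrMr//.
  rewrite (@lt_le_trans _ _ n%:R)//; first by near: n; exact: nbhs_infty_gtr.
  by rewrite -natrX ler_nat ltnW// ltn_expl.
exists n => //; have [k k2 kx] := ex_cell n axb.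
exists k => //=; rewrite mem_inner k2; apply/asboolP => y ky; apply: eU.
rewrite /ball/=.
have dk : dyadic n k.+1 = dyadic n k + (b - a) / 2 ^+ n.
  rewrite /dyadic -addrA; congr (_ + _).
  by rewrite -natr1; ring.
move: kx ky; rewrite /cell/= !in_itv/= dk => /andP[x1 x2] /andP[y1 y2].
rewrite ltr_norml; apply/andP; split; lra.
Unshelve. all: by end_near. Qed.

End dyadic_cells.

(** * Domination of a Stieltjes measure by Lebesgue measure *)

Section stieltjes_ac.
Context {R : realType}.
Variables (a b : R) (F : cumulative R R).
Hypothesis ab : a < b.
Hypothesis Fa : forall x, x <= a -> F x = F a.
Hypothesis Fb : forall x, b <= x -> F x = F b.
Notation nu := (lebesgue_stieltjes_measure F).
Notation mu := (@lebesgue_measure R).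

Lemma stieltjes_oc (x y : R) : x <= y -> nu `]x, y]%classic = (F y - F x)%:E.
Proof.
move=> xy; rewrite /lebesgue_stieltjes_measure /measure_extension.
rewrite measurable_mu_extE/=; last exact: is_ocitv.
by rewrite wlength_itv_bnd.
Qed.

Lemma stieltjes_left : nu `]-oo, a]%classic = 0%E.
Proof.
apply/eqP; rewrite eq_le measure_ge0 andbT.
have h : (nu `]-oo, a]%classic <= \sum_(0 <= n <oo) nu `](a - n%:R)%R, a]%classic)%E.
  apply: measure_sigma_subadditive => //.
  move=> x; rewrite /= in_itv/= => xa.
  have [n nx] : exists n : nat, a - x < n%:R.
    by exists (Num.trunc (a - x)).+1; rewrite truncnS_gt.
  by exists n => //=; rewrite in_itv/= xa andbT; lra.
apply: (le_trans h); rewrite eseries0// => n _ _.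
have na : a - n%:R <= a by rewrite gerBl.
by rewrite stieltjes_oc// [F (a - _)]Fa// subrr.
Qed.

Lemma stieltjes_right : nu `]b, +oo[%classic = 0%E.
Proof.
apply/eqP; rewrite eq_le measure_ge0 andbT.
have h : (nu `]b, +oo[%classic <= \sum_(0 <= n <oo) nu `]b, (b + n%:R)%R]%classic)%E.
  apply: measure_sigma_subadditive => //.
  move=> x; rewrite /= in_itv/= andbT => xa.
  have [n nx] : exists n : nat, x - b < n%:R.
    by exists (Num.trunc (x - b)).+1; rewrite truncnS_gt.
  by exists n => //=; rewrite in_itv/= xa; lra.
apply: (le_trans h); rewrite eseries0// => n _ _.
have na : b <= b + n%:R by rewrite lerDl.
by rewrite stieltjes_oc// [F (b + _)]Fb// subrr.
Qed.

Lemma stieltjes_restr A : measurable A -> nu A = nu (A `&` `]a, b]).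
Proof.
move=> mA; apply/eqP; rewrite eq_le; apply/andP; split; last first.
  by rewrite le_measure ?inE//; apply: measurableI => //; exact: measurable_itv.
have AE : A `<=` (A `&` `]a, b]) `|` (`]-oo, a] `|` `]b, +oo[).
  move=> x Ax; have [xa|ax] := leP x a; first by right; left; rewrite /= in_itv.
  have [xb|bx] := leP x b; first by left; split => //=; rewrite in_itv/= ax.
  by right; right; rewrite /= in_itv/= bx.
have m1 : measurable (`]-oo, a] : set R) by exact: measurable_itv.
have m2 : measurable (`]b, +oo[ : set R) by exact: measurable_itv.
have m3 : measurable (A `&` `]a, b]).
  by apply: measurableI => //; exact: measurable_itv.
apply: (@le_trans _ _ (nu ((A `&` `]a, b]) `|` (`]-oo, a] `|` `]b, +oo[)))).
  by rewrite le_measure ?inE//; apply: measurableU => //; exact: measurableU.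
rewrite (le_trans (measureU2 _ _ _))//; first exact: measurableU.
rewrite -[leRHS]adde0 leeD2l// (le_trans (measureU2 _ _ _))//.
by rewrite [X in (X + _)%E]stieltjes_left [X in (_ + X)%E]stieltjes_right adde0.
Qed.

Lemma stieltjes_fin : fin_num_fun nu.
Proof.
move=> A mA; rewrite ge0_fin_numE ?measure_ge0// (stieltjes_restr mA).
apply: (@le_lt_trans _ _ (nu (`]a, b]%classic : set R))).
  rewrite le_measure ?inE//.
  by apply: measurableI => //; exact: measurable_itv.
by rewrite stieltjes_oc ?ltry// ltW.
Qed.

Hypothesis acF : ac_family a b F.

(** On a cell [nu] is the increment of the monotone [F], and the total length of the inner cells is
    at most [mu U]. The same [d] serves every [n], which permits a limit in [n] afterwards. *)
Lemma stieltjes_inner_cells (e : R) : 0 < e -> exists2 d : R, 0 < d &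
  forall U n, measurable U -> (mu U < d%:E)%E -> (nu (inner_cells a b U n) <= e%:E)%E.
Proof.
move=> e0; have [d d0 H] := acF e0; exists d => // U n mU Ud.
have fin : finite_set [set` inner a b n U] by exact: finite_seq.
have uni : uniq (inner a b n U) by rewrite filter_uniq// iota_uniq.
have tri : trivIset [set` inner a b n U] (cell a b n).
  by apply: (@sub_trivIset _ _ _ setT) => //; exact: trivIset_cell.
have sumE (m : {measure set (measurableTypeR R) -> \bar R}) :
    m (inner_cells a b U n) = (\sum_(k <- inner a b n U) m (cell a b n k))%E.
  rewrite measure_fin_bigcup//; last by move=> k _; exact: measurable_itv.
  by rewrite -fsbig_seq.
pose L := [seq (dyadic a b n k, dyadic a b n k.+1) | k <- inner a b n U].
have dle k : dyadic a b n k <= dyadic a b n k.+1 by exact: dyadic_le.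
have mul : (\sum_(I <- L) (I.2 - I.1))%:E = mu (inner_cells a b U n).
  rewrite sumE big_map -sumEFin; apply: eq_bigr => k _ /=.
  rewrite lebesgue_measure_itv/= lte_fin; case: ltP => [_|]; first by rewrite EFinB.
  by move=> h; rewrite (_ : dyadic a b n k.+1 = dyadic a b n k) ?subrr//; apply/eqP; rewrite eq_le h dle.
have nul : nu (inner_cells a b U n) = (\sum_(I <- L) `|F I.2 - F I.1|)%:E.
  rewrite sumE big_map -sumEFin; apply: eq_bigr => k _ /=.
  rewrite /cell stieltjes_oc// ger0_norm// subr_ge0.
  exact: cumulative_is_nondecreasing.
rewrite nul lee_fin; apply: H.
- apply/allP => I /mapP[k]; rewrite mem_inner => /andP[k2 _] -> /=.
  rewrite /subitv/= dle -{1}(dyadic0 a b n) -{4}(dyadic_max a b n).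
  by rewrite !dyadic_le.
- rewrite /L pairwise_map.
  apply: (@sub_pairwise _ ltn); last first.
    apply: pairwise_filter; rewrite -sorted_pairwise; last exact: ltn_trans.
    exact: iota_ltn_sorted.
  by move=> i j ij /=; rewrite /apart/= dyadic_le.
- rewrite -lte_fin mul; apply: le_lt_trans Ud.
  by rewrite le_measure ?inE//;
    [exact: measurable_inner_cells|exact: inner_cells_sub].
Qed.

(** Outer regularity puts a null set into an open set of measure below [d]; continuity from below
    then passes the uniform bound on inner cells to that open set. *)
Lemma stieltjes_dominated : nu `<< mu.
Proof.
apply/null_content_dominatesP => A mA A0.
apply/eqP; rewrite eq_le measure_ge0 andbT; apply/lee_addgt0Pr => e e0.
rewrite add0e.
have [d d0 H] := stieltjes_inner_cells e0.
have d20 : 0 < d / 2 by rewrite divr_gt0.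
have [U [oU AU Ud]] := outer_measure_open_le A d20.
have mU : measurable U by exact: measurable_realfun.open_measurable.
have {}Ud : (mu U < d%:E)%E.
  apply: (le_lt_trans Ud).
  have /negligible_outer_measure -> : mu.-negligible A by exists A; split.
  by rewrite add0e lte_fin ltr_pdivrMr// ltr_pMr// ltr1n.
rewrite (stieltjes_restr mA).
have mc : measurable (\bigcup_n inner_cells a b U n).
  by apply: bigcup_measurable => n _; exact: measurable_inner_cells.
apply: (@le_trans _ _ (nu (\bigcup_n inner_cells a b U n))).
  rewrite le_measure ?inE//.
    by apply: measurableI => //; exact: measurable_itv.
  by apply: subset_trans (bigcup_inner_cells ab oU); exact: setSI.
have cv : (nu \o inner_cells a b U) n @[n --> \oo] --> nu (\bigcup_n inner_cells a b U n).
  apply: nondecreasing_cvg_mu => //; last exact: inner_cells_nd.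
  by move=> n; exact: measurable_inner_cells.
rewrite -(cvg_lim _ cv)//; apply: lime_le; first by apply/cvg_ex; eexists; exact: cv.
by apply: nearW => n; exact: H.
Qed.

End stieltjes_ac.

(** * Fundamental theorem of calculus for absolutely continuous functions *)

Section ac_density.
Context {R : realType}.
Variables (a b : R).
Hypothesis ab : a < b.
Notation mu := (@lebesgue_measure R).
Implicit Types (f g m : R -> R).

(** Composing with it extends a function on [[a, b]] by constants, giving a distribution function on
    the line whose measure is carried by []a, b]]. *)
Definition clamp (x : R) := Num.min b (Num.max a x).

Lemma clamp_itv x : a <= clamp x <= b.
Proof. by rewrite /clamp le_min ge_min le_max !lexx (ltW ab). Qed.

Lemma clamp_id x : a <= x <= b -> clamp x = x.
Proof. by move=> /andP[ax xb]; rewrite /clamp max_r// min_r. Qed.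

Lemma clamp_le x y : x <= y -> clamp x <= clamp y.
Proof.
move=> xy; rewrite /clamp le_min !ge_min lexx /=; apply/orP; right.
by rewrite ge_max !le_max lexx xy orbT.
Qed.

Lemma clamp_dist x y : x <= y -> clamp y - clamp x <= y - x.
Proof.
move=> xy; rewrite /clamp /Order.min /Order.max.
by case: (ltP a y) => ?; case: (ltP a x) => ?; case: ltP => ?; try (case: ltP => ?); lra.
Qed.

Lemma clamp_left x : x <= a -> clamp x = a.
Proof. by move=> xa; rewrite /clamp max_l// min_r// ltW. Qed.

Lemma clamp_right x : b <= x -> clamp x = b.
Proof. by move=> bx; rewrite /clamp max_r ?(le_trans (ltW ab))// min_l. Qed.

Lemma ac_family_right_continuous g : ac_family a b g ->
  forall x, (g \o clamp) @ at_right x --> g (clamp x).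
Proof.
move=> acg x; apply/cvgrPdist_le => e e0; have [d d0 H] := acg e e0.
near=> y; have xy : x <= y by near: y; exact: nbhs_right_ge.
have := H [:: (clamp x, clamp y)]; rewrite !big_seq1 /= distrC; apply => //.
  have /andP[h1 _] := clamp_itv x; have /andP[_ h2] := clamp_itv y.
  by rewrite /subitv/= h1 h2 clamp_le.
apply: (le_lt_trans (clamp_dist xy)); rewrite ltrBlDl.
by near: y; apply: nbhs_right_lt; rewrite ltrDl.
Unshelve. all: by end_near. Qed.

Lemma monotone_ac_density g : {in `[a, b] &, {homo g : x y / x <= y}} ->
  ac_family a b g ->
  exists2 f, mu.-integrable setT (EFin \o f) &
    forall x, a <= x <= b -> \int[mu]_(t in `]a, x]) f t = g x - g a.
Proof.
move=> ndg acg; pose m := g \o clamp.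
have ndm : nondecreasing m.
  by move=> x y xy; apply: ndg; rewrite ?in_itv/= ?clamp_itv//; exact: clamp_le.
have rcm : forall x, m @ at_right x --> m x by exact: ac_family_right_continuous.
pose F : cumulative R R := HB.pack m (isCumulative.Build R _ R m ndm rcm).
have Fa x : x <= a -> F x = F a by move=> xa; rewrite /F/= /m/= !clamp_left.
have Fb x : b <= x -> F x = F b by move=> xb; rewrite /F/= /m/= !clamp_right.
have acF : ac_family a b F.
  move=> e e0; have [d d0 H] := acg e e0; exists d => // L Lab aL Ld.
  rewrite (_ : \sum_(I <- L) _ = \sum_(I <- L) `|g I.2 - g I.1|); first exact: H.
  rewrite big_seq [RHS]big_seq; apply: eq_bigr => I /(allP Lab) /and3P[h1 h2 h3].
  by rewrite /F/= /m/= !clamp_id ?h1 ?h3 ?(le_trans h1 h2) ?(le_trans h2 h3).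
pose nu := lebesgue_stieltjes_measure F.
have fin_nu := stieltjes_fin ab Fa Fb.
pose nuF : {finite_measure set (measurableTypeR R) -> \bar R} :=
  HB.pack nu (Measure_isFinite.Build _ _ _ nu fin_nu).
have dom : nuF `<< mu by exact: (stieltjes_dominated ab Fa Fb acF).
have [f [f0 ffin fint fE]] := radon_nikodym_sigma_finite dom.
have fEF : EFin \o (fine \o f) = f by apply/funext => x /=; rewrite fineK.
exists (fine \o f); first by rewrite fEF.
move=> x /andP[ax xb]; rewrite /Rintegral.
rewrite (_ : (fun t => ((fine \o f) t)%:E) = f)//.
rewrite -fE; last exact: measurable_itv.
have -> : nuF `]a, x]%classic = (F x - F a)%:E by exact: stieltjes_oc.
by rewrite /F/= /m/= !clamp_id ?ax ?xb ?lexx ?ltW.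
Qed.

(** For [d] attached to the error 1, each of [N] pieces shorter than [d] contributes at most 1 to
    the variation. *)
Lemma ac_family_bounded_variation h : ac_family a b h -> bounded_variation a b h.
Proof.
move=> ach; have [d d0 H] := ac_family_TV ach ltr01.
have [N Nd] : exists N : nat, (b - a) / d < N%:R.
  by exists (Num.trunc ((b - a) / d)).+1; rewrite truncnS_gt.
have ba0 : 0 < b - a by rewrite subr_gt0.
have N0 : 0 < N%:R :> R by apply: lt_trans Nd; rewrite divr_gt0.
pose c (k : nat) := a + (b - a) * (k%:R / N%:R).
have c0 : c 0%N = a by rewrite /c mul0r mulr0 addr0.
have cN : c N = b by rewrite /c divff ?gt_eqF// mulr1 addrC subrK.
have cS k : c k.+1 - c k = (b - a) / N%:R.
  by rewrite /c -natr1; field; rewrite gt_eqF.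
have cle k : c k <= c k.+1 by rewrite -subr_ge0 cS divr_ge0// ltW.
have ca k : a <= c k.
  by rewrite -c0; elim: k => // k ih; exact: le_trans (cle k).
have TVk k : (k <= N)%N -> (total_variation a (c k) h <= k%:R%:E)%E.
  elim: k => [_|k ih kN]; first by rewrite c0 total_variationxx.
  rewrite (total_variationD h (ca k) (cle k)) -natr1 EFinD leeD ?ih ?(ltnW kN)//.
  have := H [:: (c k, c k.+1)]; rewrite !big_seq1 /= => -> //.
    rewrite /subitv/= ca cle /= -cN andbT.
    rewrite /c lerD2l ler_pM2l// ler_pM2r ?invr_gt0// ler_nat.
    exact: kN.
  by rewrite cS ltr_pdivrMr// mulrC -ltr_pdivrMr.
apply/bounded_variationP; first exact: ltW.
rewrite ge0_fin_numE ?total_variation_ge0 ?ltW//.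
by rewrite -[X in total_variation _ X]cN (le_lt_trans (TVk N _))// ltry.
Qed.

(* Radon-Nikodym for the monotone functions [V] and [V - h], where [V] is the
   variation of [h], then Lebesgue differentiation. *)
Lemma ac_density h : abs_continuous a b h ->
  exists2 f, mu.-integrable setT (EFin \o f) &
    \int[mu]_(t in `]a, b]) f t = h b - h a /\
    {ae mu, forall x, a < x < b -> derive1 h x = f x}.
Proof.
move=> /abs_continuous_family ach.
have bvh := ac_family_bounded_variation ach.
pose V x := fine (total_variation a x h).
have TVfin x y : a <= x -> x <= y -> y <= b -> total_variation x y h \is a fin_num.
  move=> ax xy yb; apply/bounded_variationP => //.
  exact: bounded_variationl xy yb (bounded_variationr ax (le_trans xy yb) bvh).
have VB x y : a <= x -> x <= y -> y <= b -> V y - V x = fine (total_variation x y h).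
  move=> ax xy yb; rewrite /V (total_variationD h ax xy).
  by rewrite fineD ?TVfin// ?(le_trans xy)// addrC addKr.
have hV x y : a <= x -> x <= y -> y <= b -> `|h y - h x| <= V y - V x.
  move=> ax xy yb; rewrite VB//; rewrite -lee_fin fineK ?TVfin//.
  exact: total_variation_ge.
have ndV : {in `[a, b] &, {homo V : x y / x <= y}}.
  move=> x y; rewrite !in_itv/= => /andP[ax _] /andP[_ yb] xy.
  by rewrite -subr_ge0 (le_trans _ (hV x y ax xy yb)).
have ndVh : {in `[a, b] &, {homo (fun x => V x - h x) : x y / x <= y}}.
  move=> x y; rewrite !in_itv/= => /andP[ax _] /andP[_ yb] xy.
  have := hV x y ax xy yb; have := ler_norm (h y - h x); lra.
have acV : ac_family a b V.
  move=> e e0; have [d d0 H] := ac_family_TV ach e0; exists d => // L Lab aL Ld.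
  rewrite -lee_fin (le_trans _ (H L Lab aL Ld))// -sumEFin big_seq [leRHS]big_seq.
  apply: lee_sum => I /(allP Lab) /and3P[h1 h2 h3].
  rewrite VB// ger0_norm ?fineK ?TVfin//.
  by rewrite fine_ge0// total_variation_ge0.
have acVh : ac_family a b (fun x => V x - h x).
  move=> e e0; have e20 : 0 < e / 2 by rewrite divr_gt0.
  have [d1 d10 H1] := ach _ e20; have [d2 d20 H2] := acV _ e20.
  exists (Num.min d1 d2); first by rewrite lt_min d10.
  move=> L Lab aL; rewrite lt_min => /andP[Ld1 Ld2].
  rewrite [leRHS](splitr e) (le_trans _ (lerD (H2 L Lab aL Ld2) (H1 L Lab aL Ld1)))//.
  rewrite -big_split/=; apply: ler_sum => I _.
  rewrite (_ : _ - _ = V I.2 - V I.1 - (h I.2 - h I.1)); last by ring.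
  exact: ler_normB.
have [f1 if1 f1E] := monotone_ac_density ndV acV.
have [f2 if2 f2E] := monotone_ac_density ndVh acVh.
have int1 D : measurable D -> mu.-integrable D (EFin \o f1).
  by move=> mD; apply: integrableS if1.
have int2 D : measurable D -> mu.-integrable D (EFin \o f2).
  by move=> mD; apply: integrableS if2.
have intB x : \int[mu]_(t in `]a, x]) (f1 t - f2 t) =
    \int[mu]_(t in `]a, x]) f1 t - \int[mu]_(t in `]a, x]) f2 t.
  rewrite RintegralB//; [exact: int1|exact: int2].
pose f x := f1 x - f2 x.
have if' : mu.-integrable setT (EFin \o f).
  have := integrableB measurableT if1 if2; apply: eq_integrable => //.
exists f => //; split.
  rewrite intB f1E ?f2E ?lexx ?ltW//; ring.
have lf : locally_integrable setT f by apply: open_integrable_locally => //; exact: openT.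
have iy y : mu.-integrable [set` Interval (BRight a) (BRight y)] (EFin \o f).
  by apply: integrableS if' => //; exact: measurable_itv.
have := FTC1 iy lf; apply: filterS; first exact: (ae_filter_ringOfSetsType mu).
move=> x Hx /andP[ax xb]; have [|dF <-] := Hx; first exact: ax.
set G := (fun x => \int[mu]_(t in _) _) in dF *.
have GE y : a <= y <= b -> G y = h y - h a.
  move=> yab; rewrite /G intB f1E// f2E//; ring.
(* The integral is known to equal [h y - h a] only on [[a, b]]; at an interior point this is a
   neighbourhood, which is all that [derive1] sees. *)
rewrite !derive1E (@near_eq_derive _ _ _ h (G \+ cst (h a))); last first.
  near=> y; rewrite /= GE ?subrK//; apply/andP; split; apply: ltW.
    by near: y; exact: lt_nbhsr.
  by near: y; exact: lt_nbhsl.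
by rewrite deriveD// derive_cst addr0.
Unshelve. all: by end_near. Qed.
End ac_density.

(** * Convexity and regular variation *)

Section convex_real.
Context {R : realType}.
Variable psi : R -> R.
Hypothesis psi_cvx : convex_function [set: R^o] (psi : R^o -> R^o).
Notation mu := (@lebesgue_measure R).

Lemma convex_le (t x y : R) : 0 <= t <= 1 ->
  psi (t * x + (1 - t) * y) <= t * psi x + (1 - t) * psi y.
Proof.
move=> /andP[t0 t1]; have := psi_cvx (Itv01 t0 t1) (mem_setT (x : R^o)) (mem_setT (y : R^o)).
by [].
Qed.

Lemma convex_chord (x s y : R) : x <= s -> s <= y ->
  (y - x) * psi s <= (y - s) * psi x + (s - x) * psi y.
Proof.
move=> xs sy; have [xy|xy] := ltP x y; last first.
  have -> : y = x by apply/eqP; rewrite eq_le xy (le_trans xs).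
  have -> : s = x by apply/eqP; rewrite eq_le xs (le_trans sy).
  by rewrite subrr !mul0r addr0.
have xy0 : 0 < y - x by rewrite subr_gt0.
have t01 : 0 <= (y - s) / (y - x) <= 1.
  by rewrite divr_ge0 ?subr_ge0 ?(ltW xy)//= ler_pdivrMr// mul1r lerD2l lerN2.
have := convex_le x y t01.
have -> : (y - s) / (y - x) * x + (1 - (y - s) / (y - x)) * y = s.
  by field; rewrite gt_eqF.
rewrite -(ler_pM2l xy0); congr (_ <= _).
by field; rewrite gt_eqF.
Qed.

(** The slope is the left derivative: the left difference quotients are bounded by every right one,
    so their supremum lies between both kinds. *)
Lemma convex_subgradient (s : R) :
  exists p, forall u, psi s + p * (u - s) <= psi u.
Proof.
pose A := [set (psi s - psi u) / (s - u) | u in [set u | u < s]].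
have ubA v : s < v -> ubound A ((psi v - psi s) / (v - s)).
  move=> sv _ [u /= us <-].
  rewrite ler_pdivrMr ?subr_gt0// mulrAC ler_pdivlMr ?subr_gt0//.
  by have := convex_chord (ltW us) (ltW sv); lra.
have supA : has_sup A.
  split; last by exists ((psi (s + 1) - psi s) / (s + 1 - s)); apply: ubA; lra.
  by exists ((psi s - psi (s - 1)) / (s - (s - 1))), (s - 1) => //=; lra.
exists (sup A) => u; have [us|su|->] := ltgtP u s.
- have : (psi s - psi u) / (s - u) <= sup A by apply: ub_le_sup; [case: supA|exists u].
  by rewrite ler_pdivrMr ?subr_gt0//; lra.
- have : sup A <= (psi u - psi s) / (u - s) by apply: ge_sup; [case: supA|exact: ubA].
  by rewrite ler_pdivlMr ?subr_gt0//; lra.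
- by rewrite subrr mulr0 addr0.
Qed.

Hypothesis psi_ge0 : forall u, 0 <= psi u.

(* The supporting line at the mean slope minorizes the integrand. *)
Lemma psi_energy_jensen (T : R) (h : R -> R) : 0 < T -> abs_continuous 0 T h ->
  ((T * psi ((h T - h 0) / T))%:E <= psi_energy psi T h)%E.
Proof.
move=> T0 ach; have [f intf [fh [N [mN N0 fN]]]] := ac_density T0 ach.
set s := (h T - h 0) / T; have [p psi_p] := convex_subgradient s.
pose ell x := psi s + p * (f x - s).
(* The positive part is still below [psi] because [psi] is nonnegative, and the indicator in [G]
   kills the null set where [derive1 h] may differ from [f]. Thus [G] is a measurable minorant at
   every point, with the same integral as [g]. *)
pose g := (EFin \o ell)^\+%E.
pose G x := (g x * (\1_(~` N) x)%:E)%E.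
have mD : measurable (`]0, T[ : set (measurableTypeR R)) by exact: measurable_itv.
have intfD : mu.-integrable `]0, T[ (EFin \o f) by apply: integrableS intf.
have muD : mu `]0, T[%classic = T%:E.
  by rewrite lebesgue_measure_itv/= lte_fin T0 -EFinD oppr0 addr0.
have intcD r : mu.-integrable `]0, T[ (EFin \o cst r).
  apply/integrableP; split; first exact/measurable_EFinP/measurable_cst.
  rewrite [X in (X < _)%E](_ : _ = (`|r|%:E * mu `]0%R, T[%classic)%E); last first.
    by rewrite -integral_cst.
  by rewrite muD -EFinM ltry.
have intZ : mu.-integrable `]0, T[ (EFin \o (fun x => p * f x)).
  by have := integrableZl mD p intfD; apply: eq_integrable.
have intell : mu.-integrable `]0, T[ (EFin \o ell).
  have := integrableD mD (intcD (psi s - p * s)) intZ.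
  by apply: eq_integrable => // x _ /=; rewrite -EFinD /ell; congr EFin; ring.
have ellE : (\int[mu]_(x in `]0%R, T[) (ell x)%:E)%E = (T * psi s)%:E.
  rewrite -[LHS]fineK; last exact: integrable_fin_num intell.
  congr EFin; rewrite -/(Rintegral _ _ _).
  rewrite (_ : ell = fun x => (psi s - p * s) + p * f x); last first.
    by apply/funext => x; rewrite /ell; ring.
  rewrite RintegralD//; last exact: intcD.
  rewrite Rintegral_cst// RintegralZl// Rintegral_itv_bndo_bndc// fh.
  have hs : h T - h 0 = s * T by rewrite divfK ?gt_eqF.
  rewrite hs [X in _ * X + _](_ : _ = T); last exact: (congr1 fine muD).
  by ring.
have mg : measurable_fun `]0, T[ g.
  by apply: measurable_funepos; case/integrableP: intell.
have mG : measurable_fun `]0, T[ G.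
  apply: emeasurable_funM => //; apply/measurable_EFinP.
  by apply: measurable_funTS; apply: measurable_indic; exact: measurableC.
have g0 x : (0 <= g x)%E by exact: funepos_ge0.
have G0 x : (0 <= G x)%E by rewrite mule_ge0// lee_fin.
apply: (@le_trans _ _ (\int[mu]_(x in `]0%R, T[) G x)%E); last first.
  apply: ge0_lower_integral_le => x; first by move=> _; exact: G0.
  rewrite /= in_itv/= => xT; rewrite /G indicE.
  case: (boolP (x \in _)) => [/set_mem xN|_]; last by rewrite mule0 lee_fin.
  rewrite mule1 /g funeposE ge_max !lee_fin psi_ge0 andbT.
  suff -> : derive1 h x = f x by rewrite psi_p.
  by apply: contrapT => Hx; apply: xN; apply: fN => /=; move/(_ xT).
rewrite (_ : (\int[mu]_(x in `]0%R, T[) G x)%E = (\int[mu]_(x in `]0%R, T[) g x)%E).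
  rewrite -ellE integralE [leRHS](_ : _ = (\int[mu]_(x in `]0%R, T[) g x - 0)%E).
    by rewrite leeB// integral_ge0// => x _; exact: funeneg_ge0.
  by rewrite sube0.
apply: ge0_ae_eq_integral => //; exists N; split => // x /=.
move/not_implyP => [_ Gx]; apply: contrapT => xN; apply: Gx.
by rewrite /G indicE mem_set// mule1.
Qed.

End convex_real.

(** * Regular variation at zero and a Potter bound *)

Section regularly_varying_convex.
Context {R : realType}.
Variables (psi theta : R -> R) (kappa : R).
Hypothesis psi_ge0 : forall u : R, 0 <= psi u.
Hypothesis psi_cvx : convex_function [set: R^o] (psi : R^o -> R^o).
Hypothesis kappa_ge1 : 1 <= kappa.
Hypothesis psi_eq : forall u : R, 0 < u -> psi u = u `^ kappa * theta u.
Hypothesis theta_sv : slowly_varying_at0 theta.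

Lemma psi_gt0 : \forall u \near (0 : R)^'+, 0 < psi u.
Proof.
have [[a a0 [_ tha]] _] := theta_sv.
near=> u; have u0 : 0 < u by near: u; exact: nbhs_right_gt.
rewrite psi_eq// mulr_gt0 ?powR_gt0// tha// u0/=.
by near: u; exact: nbhs_right_lt.
Unshelve. all: by end_near. Qed.

Lemma psi_ratio (l : R) : 0 < l ->
  psi (l * u) / psi u @[u --> (0 : R)^'+] --> l `^ kappa.
Proof.
move=> l0; have [[a a0 [_ tha]] /(_ l l0) sv] := theta_sv.
have cv : l `^ kappa * (theta (l * u) / theta u) @[u --> (0 : R)^'+] --> l `^ kappa.
  by rewrite -[X in _ --> X]mulr1; apply: cvgM => //; exact: cvg_cst.
apply: cvg_trans cv; apply: near_eq_cvg; near=> u.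
have u0 : 0 < u by near: u; exact: nbhs_right_gt.
have tu : 0 < theta u.
  by apply: tha; rewrite u0/=; near: u; exact: nbhs_right_lt.
rewrite !psi_eq ?mulr_gt0// powRM ?ltW//.
by field; rewrite !gt_eqF ?powR_gt0.
Unshelve. all: by end_near. Qed.

Lemma psi_ratio_le (l c : R) : 0 < l -> l `^ kappa < c ->
  \forall u \near (0 : R)^'+, psi (l * u) <= c * psi u.
Proof.
move=> l0 lc; near=> u; have pu : 0 < psi u by near: u; exact: psi_gt0.
rewrite -ler_pdivrMr// ltW//; near: u; exact: cvgr_lt (psi_ratio l0) _ lc.
Unshelve. all: by end_near. Qed.

Lemma psi_ratio_ge (l c : R) : 0 < l -> c < l `^ kappa ->
  \forall u \near (0 : R)^'+, c * psi u <= psi (l * u).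
Proof.
move=> l0 lc; near=> u; have pu : 0 < psi u by near: u; exact: psi_gt0.
rewrite -ler_pdivlMr// ltW//; near: u; exact: cvgr_gt (psi_ratio l0) _ lc.
Unshelve. all: by end_near. Qed.

(* The affine bounds at [0] that convexity provides would force
   [psi (u / 2) / psi u --> 1] if [psi 0] were positive. *)
Lemma psi0 : psi 0 = 0.
Proof.
apply/eqP; rewrite eq_le psi_ge0 andbT leNgt; apply/negP => p0.
have [p psi_p] := convex_subgradient psi_cvx 0.
(* As [kappa >= 1], the limit of [psi (u / 2) / psi u] is at most 1/2; 3/4 is an arbitrary number
   strictly between this and 1. *)
have h34 : (2^-1 : R) `^ kappa < 3 / 4.
  apply: (@le_lt_trans _ _ 2^-1); last by lra.
  by apply: ge1r_powR => //; lra.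
pose C := 3 / 4 * (psi 1 - psi 0) - p / 2.
near (0 : R)^'+ => u; have u0 : 0 < u by near: u; exact: nbhs_right_gt.
have u1 : u <= 1 by near: u; exact: nbhs_right_le.
have h1 : psi (2^-1 * u) <= 3 / 4 * psi u.
  by near: u; apply: psi_ratio_le => //; rewrite invr_gt0.
have h2 : psi 0 + p * (2^-1 * u - 0) <= psi (2^-1 * u) by exact: psi_p.
have h3 : psi u <= psi 0 + u * (psi 1 - psi 0).
  have := @convex_le R psi psi_cvx u 1 0; rewrite ltW// u1 => /(_ erefl).
  by rewrite mulr1 mulr0 addr0; lra.
have h4 : u * (`|C| + 1) < psi 0 / 4.
  rewrite -ltr_pdivlMr ?ltr_wpDl//; near: u; apply: nbhs_right_lt.
  by rewrite !divr_gt0// ltr_wpDl.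
have h5 : u * C <= u * (`|C| + 1).
  by rewrite ler_pM2l// ler_wpDr// ler_norm.
by move: h5; rewrite /C; nra.
Unshelve. all: by end_near. Qed.

(** The chord from the origin gives [psi x <= (x / y) * psi y] for positive [y]. *)
Lemma psi_nd (x y : R) : 0 <= x -> x <= y -> psi x <= psi y.
Proof.
move=> x0 xy; have [y0|y0] := leP y 0.
  by have -> : x = y by apply/eqP; rewrite eq_le xy (le_trans y0).
have := convex_chord psi_cvx x0 xy; rewrite psi0 mulr0 add0r !subr0.
by move=> h; rewrite -(ler_pM2l y0) (le_trans h)// ler_wpM2r.
Qed.

(** Near zero [psi (q * v) <= q^p * psi v], since [q^kappa < q^p]. This is iterated along [v],
    [q * v], [q^2 * v] and so on until [u] is passed; monotonicity bridges the last incomplete step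
    at the price of the extra factor [q^p]. *)
Lemma psi_potter (p q : R) : kappa < p -> 1 < q -> exists2 u0 : R, 0 < u0 &
  forall u v r, 0 < u < u0 -> 0 < v < u0 -> 1 <= r -> u <= r * v ->
  psi u <= (q * r) `^ p * psi v.
Proof.
move=> kp q1; have q0 : 0 < q by lra.
have p0 : 0 <= p by rewrite (le_trans _ (ltW kp))// (le_trans _ kappa_ge1).
have qkp : q `^ kappa < q `^ p.
  by rewrite /powR gt_eqF// ltr_expR ltr_pM2r// ln_gt0.
have := psi_ratio_le q0 qkp; rewrite /at_right near_withinE.
rewrite -filter_from_ballE => -[u0 /= u00 H]; exists u0 => //.
have {}H v : 0 < v < u0 -> psi (q * v) <= q `^ p * psi v.
  move=> /andP[v0 vu]; apply: H => //.
  by rewrite /ball/= sub0r normrN gtr0_norm.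
have qr r : 1 <= r -> q `^ p <= (q * r) `^ p.
  move=> r1; apply: ge0_ler_powR => //; rewrite ?nnegrE ?ler_peMr//; nra.
suff main n u v r : r <= q ^+ n -> 0 < u < u0 -> 0 < v < u0 -> 1 <= r ->
    u <= r * v -> psi u <= (q * r) `^ p * psi v.
  move=> u v r uu vv r1 uv.
  have [n rn] : exists n, r <= q ^+ n.
    exists (Num.trunc (r / (q - 1))).+1.
    have := truncnS_gt (r / (q - 1)); set n := (Num.trunc _).+1.
    rewrite ltr_pdivrMr ?subr_gt0// => /ltW /le_trans; apply.
    elim: n => [|n ih]; first by rewrite mul0r expr0 ler01.
    rewrite exprSr -natr1; have : 0 <= n%:R :> R by [].
    have : 1 <= q ^+ n by rewrite exprn_ege1// ltW.
    nra.
  exact: main rn uu vv r1 uv.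
elim: n u v r => [|n ih] u v r rn uu vv r1 uv.
  rewrite (le_trans (psi_nd _ (_ : u <= v)))//.
  - by case/andP: uu => /ltW.
  - by rewrite (le_trans uv)// ler_piMl// ltW//; case/andP: vv.
  - have h1 : (1 : R) `^ p = 1 by rewrite powR1.
    by rewrite ler_peMl// -h1 ge0_ler_powR ?nnegrE//; nra.
have [u0' uu0] := andP uu; have [v0 vu0] := andP vv.
have [uqv|qvu] := leP u (q * v).
  apply: (le_trans (psi_nd (ltW u0') uqv)); apply: (le_trans (H _ vv)).
  by rewrite ler_wpM2r// qr.
have rq : q <= r by rewrite -(ler_pM2r v0) (le_trans (ltW qvu)).
(* The induction replaces [v] by [q * v], which stays below [u0] because it is still below [u]. *)
have qv : 0 < q * v < u0 by rewrite mulr_gt0//= (lt_trans qvu).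
have := ih u (q * v) (r / q); rewrite ler_pdivrMr// -exprSr => /(_ rn uu qv).
rewrite ler_pdivlMr// mul1r mulrA divfK ?gt_eqF// => /(_ rq uv).
rewrite mulrCA divff ?gt_eqF// mulr1 => /le_trans; apply.
have r0 : 0 <= r by rewrite (le_trans _ r1).
rewrite powRM//; last exact: ltW.
by rewrite -mulrA mulrCA ler_wpM2l ?powR_ge0// H.
Qed.

End regularly_varying_convex.

(** * Deterministic bounds *)

Section lil_scale.
Context {R : realType}.
Implicit Types (T t M e : R).

Definition lil_slope T : R := Num.sqrt (ln (ln T) / T).
Definition lil_env T : R := Num.sqrt (2 * T * ln (ln T)).

Lemma lnln_ge M T : expR (expR M) <= T -> M <= ln (ln T).
Proof.
move=> MT; have T0 : 0 < T by rewrite (lt_le_trans _ MT)// expR_gt0.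
have h : expR M <= ln T by rewrite -(expRK (expR M)) ler_ln ?posrE ?expR_gt0.
have lT0 : 0 < ln T by rewrite (lt_le_trans _ h)// expR_gt0.
by rewrite -(expRK M) ler_ln ?posrE ?expR_gt0.
Qed.

Lemma lnlnT_ge1 T : expR (expR 1) <= T -> [/\ 1 <= ln (ln T), 1 <= ln T & 1 <= T].
Proof.
move=> hT; have h1 := lnln_ge hT.
have T0 : 0 < T by rewrite (lt_le_trans _ hT)// expR_gt0.
have e1 : 1 <= expR (1 : R) by rewrite (le_trans _ (expR_ge1Dx _))// lerDl.
have h2 : expR 1 <= ln T by rewrite -(expRK (expR 1)) ler_ln ?posrE ?expR_gt0.
split => //; first exact: le_trans h2.
by rewrite (le_trans _ hT)// (le_trans _ (expR_ge1Dx _))// lerDl ltW// expR_gt0.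
Qed.

Lemma ln_le_id T : 0 < T -> ln T <= T.
Proof. by move=> T0; have := @ln_sublinear R T T0; move/ltW. Qed.

Lemma lnln_mono s t : expR (expR 1) <= s -> s <= t -> ln (ln s) <= ln (ln t).
Proof.
move=> es st; have [_ l1 s1] := lnlnT_ge1 es.
have [_ l2 t1] := lnlnT_ge1 (le_trans es st).
by rewrite ler_ln ?posrE ?(lt_le_trans _ l1) ?(lt_le_trans _ l2)// ler_ln ?posrE ?(lt_le_trans _ s1) ?(lt_le_trans _ t1).
Qed.

Lemma lil_slope_gt0 T : expR (expR 1) <= T -> 0 < lil_slope T.
Proof.
move=> /lnlnT_ge1[h1 h2 h3]; rewrite sqrtr_gt0 divr_gt0//.
  by rewrite (lt_le_trans _ h1).
by rewrite (lt_le_trans _ h3).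
Qed.

(** The slope tends to zero from the right: [ln (ln T) <= ln T = 2 * ln (sqrt T) < 2 * sqrt T], so
    its square is below [2 / sqrt T]. *)
Lemma near_lil_slope (P : R -> Prop) : (\forall v \near 0^'+, P v) ->
  \forall T \near +oo, P (lil_slope T).
Proof.
rewrite /at_right near_withinE -filter_from_ballE => -[e /= e0 eP].
near=> T; have hT : expR (expR 1) <= T.
  by near: T; apply: nbhs_pinfty_ge; exact: num_real.
have [h1 h2 h3] := lnlnT_ge1 hT; have T0 : 0 < T by exact: lt_le_trans h3.
apply: eP; last exact: lil_slope_gt0.
rewrite /ball/= sub0r normrN gtr0_norm ?lil_slope_gt0//.
rewrite -[X in _ < X](gtr0_norm e0) -sqrtr_sqr /lil_slope ltr_sqrt ?exprn_gt0//.
have s0 : 0 < Num.sqrt T by rewrite sqrtr_gt0.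
have sT : Num.sqrt T ^+ 2 = T by rewrite sqr_sqrtr// ltW.
have e20 : 0 < e ^+ 2 by rewrite exprn_gt0.
have sl : 2 / e ^+ 2 <= Num.sqrt T.
  have hT2 : (2 / e ^+ 2) ^+ 2 <= T.
    by near: T; apply: nbhs_pinfty_ge; exact: num_real.
  by rewrite (le_trans (ler_norm _))// -sqrtr_sqr ler_wsqrtr.
have hl : ln (ln T) < 2 * Num.sqrt T.
  apply: (@le_lt_trans _ _ (ln T)).
    by apply: ln_le_id; exact: lt_le_trans h2.
  have -> : ln T = 2 * ln (Num.sqrt T) by rewrite -{1}sT lnXn// mulr_natl.
  by rewrite ltr_pM2l// ln_sublinear.
rewrite ltr_pdivrMr// (lt_le_trans hl)// -[in leRHS]sT expr2 mulrA.
rewrite ler_pM2r//; move: sl; rewrite ler_pdivrMr//; by rewrite mulrC.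
Unshelve. all: by end_near. Qed.

Lemma lil_env_slope T : expR (expR 1) <= T ->
  lil_env T / T = Num.sqrt 2 * lil_slope T.
Proof.
move=> /lnlnT_ge1[h1 h2 h3]; have T0 : 0 < T by exact: lt_le_trans h3.
rewrite /lil_env /lil_slope -sqrtrM//.
rewrite -[X in _ / X](gtr0_norm T0) -sqrtr_sqr -sqrtrV ?sqr_ge0// -sqrtrM.
  by congr Num.sqrt; field; rewrite gt_eqF.
have l0 : 0 <= ln (ln T) by exact: le_trans h1.
by rewrite !mulr_ge0// ltW.
Qed.

End lil_scale.

(** * Lower bound on the energy from the final value *)

Section deterministic_lower_bound.
Context {R : realType}.
Variables (psi theta : R -> R) (kappa : R).
Hypothesis psi_ge0 : forall u : R, 0 <= psi u.
Hypothesis psi_cvx : convex_function [set: R^o] (psi : R^o -> R^o).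
Hypothesis kappa_bounds : 1 <= kappa < 2.
Hypothesis psi_eq : forall u : R, 0 < u -> psi u = u `^ kappa * theta u.
Hypothesis theta_sv : slowly_varying_at0 theta.
Variables (w : R -> R) (r : R).

Lemma min_energy_ge (T s : R) : 0 < T -> 0 <= s -> s * T <= w T - r ->
  ((T * psi s)%:E <= min_energy psi w T r)%E.
Proof.
move=> T0 s0 sT; apply: le_ereal_inf_tmp => _ /= [h [ach h0 hw] <-].
apply: le_trans (psi_energy_jensen psi_cvx psi_ge0 T0 ach).
have [k1 _] := andP kappa_bounds.
rewrite lee_fin ler_pM2l// (psi_nd psi_ge0 psi_cvx k1 psi_eq theta_sv)//.
rewrite ler_pdivlMr// (le_trans sT)// h0 lerD2r hw// lexx andbT; exact: ltW.
Qed.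

Lemma normalized_min_energy_ge (c : R) : 0 < c -> c < 2 `^ (kappa / 2) ->
  (forall e M : R, 0 < e -> exists2 T, M < T & (1 - e) * lil_env T <= w T) ->
  forall M : R, exists2 T, M < T &
    (c%:E <= min_energy psi w T r * ((T * psi (lil_slope T))^-1)%:E)%E.
Proof.
move=> c0 cK lil M; have [k1 k2] := andP kappa_bounds.
set K := 2 `^ (kappa / 2) in cK; have K0 : 0 < K by rewrite /K powR_gt0.
(* Since [kappa <= 2], [(1 - d)^kappa >= (1 - d)^2 >= 1 - 2 * d]; the second entry makes [2 * d * K]
   at most half of [K - c]. *)
pose d := Num.min 4^-1 ((K - c) / (4 * K)).
have d0 : 0 < d by rewrite lt_min invr_gt0 ltr0n divr_gt0 ?subr_gt0 ?mulr_gt0.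
have d4 : d <= 4^-1 by rewrite /d ge_min lexx.
have dK : d * (4 * K) <= K - c.
  by rewrite -ler_pdivlMr ?mulr_gt0// /d ge_min lexx orbT.
pose l := (1 - d) * Num.sqrt 2.
have l0 : 0 < l by rewrite mulr_gt0 ?sqrtr_gt0// subr_gt0; lra.
have lK : c < l `^ kappa.
  have -> : l `^ kappa = (1 - d) `^ kappa * K.
    rewrite /l powRM ?sqrtr_ge0//; last by lra.
    by rewrite /K -powR12_sqrt// -powRrM [2^-1 * _]mulrC.
  have : (1 - d) ^+ 2 <= (1 - d) `^ kappa.
    rewrite -powR_mulrn; last by lra.
    by apply: ger_powR; [lra|exact: ltW].
  move=> h; apply: (@lt_le_trans _ _ ((1 - d) ^+ 2 * K)); last first.
    by rewrite ler_wpM2r// ltW.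
  by nra.
have Hr := psi_ratio_ge psi_eq theta_sv l0 lK.
have [M0 [_ HM0]] := near_lil_slope (filterI Hr (psi_gt0 psi_eq theta_sv)).
have d20 : 0 < d / 2 by rewrite divr_gt0.
(* Half of [d] is spent on the iterated logarithm and half on absorbing [r]: beyond
   [(2 * r / d) ^+ 2] one has [r <= d / 2 * lil_env T]. *)
have [T TM lilT] := lil (d / 2) (Num.max M (Num.max M0 (Num.max (expR (expR 1)) ((2 * r / d) ^+ 2)))) d20.
move: TM; rewrite !gt_max => /and4P[MT M0T eT rT].
exists T => //; have [ratT psT] := HM0 T M0T.
have [h1 h2 h3] := lnlnT_ge1 (ltW eT); have T0 : 0 < T by exact: lt_le_trans h3.
have env_r : 2 * r / d <= lil_env T.
  apply: (@le_trans _ _ (Num.sqrt ((2 * r / d) ^+ 2))).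
    by rewrite sqrtr_sqr ler_norm.
  rewrite ler_wsqrtr// (le_trans (ltW rT))// -mulrA mulrCA ler_peMr ?ltW//.
  lra.
have env0 : 0 <= lil_env T by exact: sqrtr_ge0.
have ET : lil_env T = Num.sqrt 2 * lil_slope T * T.
  by rewrite -(lil_env_slope (ltW eT)) divfK// gt_eqF.
have sl0 : 0 < lil_slope T by exact: lil_slope_gt0 (ltW eT).
have Ege : ((T * psi (l * lil_slope T))%:E <= min_energy psi w T r)%E.
  apply: min_energy_ge => //; first by rewrite mulr_ge0// ltW.
  have -> : l * lil_slope T * T = (1 - d) * lil_env T by rewrite ET /l; ring.
  move: env_r; rewrite ler_pdivrMr//; nra.
rewrite lee_pdivlMr ?mulr_gt0// -EFinM (le_trans _ Ege)// lee_fin.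
by rewrite mulrCA ler_pM2l.
Qed.

End deterministic_lower_bound.

(** * Energy of a line followed by a translated curve *)

Section majorant.
Context {R : realType}.
Notation mu := (@lebesgue_measure R).

Lemma lipschitz_abs_continuous (a b M : R) (f : R -> R) : 0 <= M ->
  (forall x y, a <= x -> x <= y -> y <= b -> `|f y - f x| <= M * (y - x)) ->
  abs_continuous a b f.
Proof.
move=> M0 fM e e0; have M10 : 0 < M + 1 by rewrite ltr_wpDl.
exists (e / (M + 1)); first by rewrite divr_gt0.
move=> n x y xy _; rewrite ltr_pdivlMr// => xyd.
apply: (@le_lt_trans _ _ (M * \sum_(i < n) (y i - x i))).
  by rewrite mulr_sumr; apply: ler_sum => i _; have [? ? ?] := xy i; exact: fM.
apply: le_lt_trans xyd; rewrite mulrC ler_wpM2l ?lerDl//.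
by apply: sumr_ge0 => i _; rewrite subr_ge0; case: (xy i).
Qed.

Lemma integral_powRN (a b beta : R) : 0 < a -> a < b -> beta < 1 ->
  (\int[mu]_(s in `]a, b[) (s `^ (- beta))%:E <=
   (b `^ (1 - beta) / (1 - beta))%:E)%E.
Proof.
move=> a0 ab b1; pose F s : R := s `^ (1 - beta) / (1 - beta).
have nb0 : 1 - beta != 0 by rewrite gt_eqF// subr_gt0.
have dF (s : R) : 0 < s -> is_derive s 1 F (s `^ (- beta)).
  move=> s0; have := is_derive1_powR (1 - beta) s0 => dp.
  have -> : s `^ (- beta) = (1 - beta)^-1 *: ((1 - beta) * s `^ (1 - beta - 1)).
    rewrite [RHS]mulrA mulVf// mul1r; congr (_ `^ _); ring.
  rewrite (_ : F = (1 - beta)^-1 \*: (fun s => s `^ (1 - beta))).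
    exact: is_deriveZ.
  by apply/funext => t; rewrite /F/= mulrC.
have dp (s : R) : 0 < s -> derivable (fun s : R => s `^ (- beta)) s 1.
  by move=> s0; have [] := is_derive1_powR (- beta) s0.
have cF (s : R) : 0 < s -> {for s, continuous F}.
  move=> s0; apply: differentiable_continuous; apply/derivable1_diffP.
  by have [] := dF s s0.
rewrite (_ : (\int[mu]_(s in _) _)%E =
    (\int[mu]_(s in `[a, b]) (s `^ (- beta))%:E)%E); last first.
  apply/esym; apply: integral_itv_bndoo.
  apply/measurable_EFinP; apply: measurable_funTS; exact: measurable_powR.
rewrite (@continuous_FTC2 _ _ F)//.
- rewrite -EFinB lee_fin gerBl divr_ge0 ?powR_ge0// subr_ge0 ltW//.
- apply: derivable_within_continuous => s; rewrite in_itv/= => /andP[sa _].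
  by apply: dp; exact: lt_le_trans sa.
- split.
  + move=> s; rewrite in_itv/= => /andP[sa _].
    by have [] := dF s (lt_trans a0 sa).
  + by apply: cvg_at_right_filter; exact: cF.
  + by apply: cvg_at_left_filter; apply: cF; exact: lt_trans ab.
- move=> s; rewrite in_itv/= => /andP[sa _]; rewrite derive1E.
  by have [_ ->] := dF s (lt_trans a0 sa).
Qed.

Variables (r K t0 M : R) (B dB : R -> R).
Hypothesis t0_gt0 : 0 < t0.
Hypothesis K_ge0 : 0 <= K.
Hypothesis B_derive : forall t, t0 <= t -> is_derive t 1 B (dB t).
Hypothesis dB_bounds : forall t, t0 <= t -> 0 <= dB t <= M.

Definition majorant t := r + K * Num.min t t0 + (B (Num.max t t0) - B t0).

Lemma majorant_left t : t <= t0 -> majorant t = r + K * t.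
Proof. by move=> tt0; rewrite /majorant min_l// max_r// subrr addr0. Qed.

Lemma majorant_right t : t0 <= t -> majorant t = r + K * t0 + (B t - B t0).
Proof. by move=> tt0; rewrite /majorant min_r// max_l. Qed.

Lemma majorant_B_lip x y : t0 <= x -> x <= y -> 0 <= B y - B x <= M * (y - x).
Proof.
move=> tx xy; have [||c] := @MVT_segment R B dB x y xy.
- by move=> t; rewrite in_itv/= => /andP[xt _]; apply: B_derive; exact: le_trans tx (ltW xt).
- apply: derivable_within_continuous => t; rewrite in_itv/= => /andP[xt _].
  by have [] := B_derive (le_trans tx xt).
rewrite in_itv/= => /andP[xc _] ->.
have /andP[d0 dM] := dB_bounds (le_trans tx xc).
by rewrite mulr_ge0 ?subr_ge0//= ler_wpM2r// subr_ge0.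
Qed.

Lemma majorant_ac T : abs_continuous 0 T majorant.
Proof.
have M0 : 0 <= M by have /andP[d0 ?] := dB_bounds (lexx t0); exact: le_trans d0 _.
apply: (@lipschitz_abs_continuous _ _ (K + M)); first exact: addr_ge0.
move=> x y _ xy _.
have [yt|ty] := leP y t0.
  rewrite !majorant_left ?(le_trans xy)// opprD addrACA subrr add0r -mulrBr.
  by rewrite ger0_norm ?mulr_ge0 ?subr_ge0// ler_wpM2r ?subr_ge0// lerDl.
have [xt|tx] := leP x t0.
  rewrite (majorant_left xt) (majorant_right (ltW ty)).
  have /andP[b0 bM] := majorant_B_lip (lexx t0) (ltW ty).
  have h1 : 0 <= K * (t0 - x) by rewrite mulr_ge0 ?subr_ge0.
  have h2 : 0 <= K * (y - t0) by rewrite mulr_ge0 ?subr_ge0// ltW.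
  have h3 : 0 <= M * (t0 - x) by rewrite mulr_ge0 ?subr_ge0.
  by rewrite ger0_norm; lra.
rewrite (majorant_right (ltW tx)) (majorant_right (ltW ty)).
have /andP[b0 bM] := majorant_B_lip (ltW tx) xy.
have h1 : 0 <= K * (y - x) by rewrite mulr_ge0 ?subr_ge0.
by rewrite ger0_norm; lra.
Qed.

Lemma derive1_majorant_left t : t < t0 -> derive1 majorant t = K.
Proof.
move=> tt0; rewrite derive1E (@near_eq_derive _ _ _ _ (cst r + K \*: id)).
  by rewrite deriveD// derive_cst deriveZ// derive_id add0r; exact: mulr1.
near=> s; rewrite majorant_left//; apply: ltW; near: s; exact: lt_nbhsl.
Unshelve. all: by end_near. Qed.

Lemma derive1_majorant_right t : t0 < t -> derive1 majorant t = dB t.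
Proof.
move=> tt0; have [dvB DB] := B_derive (ltW tt0).
rewrite derive1E (@near_eq_derive _ _ _ _ (cst (r + K * t0 - B t0) + B)).
  by rewrite deriveD// derive_cst add0r.
near=> s; rewrite majorant_right; last first.
  by apply: ltW; near: s; exact: lt_nbhsr.
by transitivity (r + K * t0 - B t0 + B s); [ring|].
Unshelve. all: by end_near. Qed.

Variable psi : R -> R.
Hypothesis psi_ge0 : forall u, 0 <= psi u.

Lemma majorant_energy (T k beta : R) : t0 < T -> 0 <= k -> beta < 1 ->
  (forall s, t0 < s -> s < T -> psi (dB s) <= k * s `^ (- beta)) ->
  (psi_energy psi T majorant <=
   (Num.max (psi K) (psi (derive1 majorant t0)) * t0 +
    k * (T `^ (1 - beta) / (1 - beta)))%:E)%E.
Proof.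
(* The path has a kink at [t0], where [derive1] may take its default value. Including that value in
   [C0] makes the comparison function a majorant at every point. *)
move=> tT k0 b1 psi_dB; set C0 := Num.max _ _.
have C00 : 0 <= C0 by rewrite le_max psi_ge0.
pose g s : \bar R := (C0 * \1_(`]-oo, t0]) s + k * (s `^ (- beta) * \1_(`]t0, +oo[) s))%:E.
have mg : measurable_fun setT g.
  apply/measurable_EFinP; apply: measurable_funD; apply: measurable_funM => //.
  apply: measurable_funM; first exact: measurable_powR.
  by apply: measurable_indic; exact: measurable_itv.
have g0 s : (0 <= g s)%E.
  by rewrite lee_fin addr_ge0// mulr_ge0// mulr_ge0// powR_ge0.
have gl s : s <= t0 -> g s = C0%:E.
  move=> st; rewrite /g !indicE mem_set/= ?in_itv//= memNset/= ?in_itv/=; last first.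
    by rewrite andbT; apply/negP; rewrite -leNgt.
  by rewrite mulr1 !mulr0 addr0.
have gr s : t0 < s -> g s = (k * s `^ (- beta))%:E.
  move=> st; rewrite /g !indicE memNset/= ?in_itv//=; last by apply/negP; rewrite -ltNge.
  by rewrite mem_set/= ?in_itv/= ?st// mulr0 add0r mulr1.
apply: (@le_trans _ _ (\int[mu]_(s in `]0%R, T[) g s)%E).
  apply: ge0_lower_integral_le => s; first by rewrite lee_fin.
  rewrite /= in_itv/= => /andP[s0 sT].
  have [st|ts|->] := ltgtP s t0.
  - by rewrite (gl _ (ltW st)) lee_fin derive1_majorant_left// le_max lexx.
  - by rewrite gr// lee_fin derive1_majorant_right// psi_dB.
  - by rewrite gl// lee_fin le_max lexx orbT.
rewrite (@itv_bndbnd_setU _ _ _ (BRight t0))//; [|by rewrite bnd_simp ltW..].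
rewrite ge0_integral_setU//=; last first.
- apply/disj_setPLR => s /=; rewrite !in_itv/= => /andP[_ st].
  by apply/negP; rewrite negb_and -leNgt st.
- exact: measurable_funTS.
rewrite EFinD; apply: leeD.
  rewrite (eq_integral (cst C0%:E)); last first.
    by move=> s; rewrite inE/= in_itv/= => /andP[_ st]; rewrite gl.
  rewrite integral_cst//= lebesgue_measure_itv/= lte_fin t0_gt0.
  by rewrite oppr0 adde0 -EFinM.
rewrite (_ : (\int[mu]_(s in `]t0, T[) g s)%E =
    (\int[mu]_(s in `]t0, T[) (k%:E * (s `^ (- beta))%:E))%E); last first.
  by apply: eq_integral => s; rewrite inE/= in_itv/= => /andP[st _]; rewrite gr.
rewrite ge0_integralZl//=; last 2 first.
- by apply/measurable_EFinP; apply: measurable_funTS; exact: measurable_powR.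
- by move=> s _; rewrite lee_fin powR_ge0.
by rewrite EFinM lee_wpmul2l// integral_powRN.
Qed.

End majorant.

(** * Slope of the iterated-logarithm envelope *)

Section lil_env_derivative.
Context {R : realType}.
Implicit Types t : R.

Definition lil_env_deriv t : R := (ln (ln t) + (ln t)^-1) / lil_env t.

Lemma is_derive_lil_env t : expR (expR 1) <= t ->
  is_derive t 1 (@lil_env R) (lil_env_deriv t).
Proof.
move=> et; have [h1 h2 h3] := lnlnT_ge1 et.
have t0 : 0 < t by exact: lt_le_trans h3.
have l0 : 0 < ln t by exact: lt_le_trans h2.
have ll0 : 0 < ln (ln t) by exact: lt_le_trans h1.
have d1 : is_derive t 1 (@ln R \o @ln R) ((ln t)^-1 * t^-1).
  by apply: is_derive1_comp; exact: is_derive1_ln.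
have d2 : is_derive t 1 (2 \*: @id R) (2 *: 1) by exact: is_deriveZ.
have d3 := is_deriveM d2 d1.
have E0 : 0 < 2 * t * ln (ln t) by rewrite !mulr_gt0.
have d4 := @is_derive1_comp R Num.sqrt (2 \*: @id R * (@ln R \o @ln R)) t _ _
  (is_derive1_sqrt E0) d3.
apply: is_derive_eq d4 _.
rewrite /lil_env_deriv /lil_env /GRing.scale/=.
have s0 : Num.sqrt (2 * t * ln (ln t)) != 0 by rewrite gt_eqF// sqrtr_gt0.
rewrite (_ : 2 *: t = 2 * t)//.
by field; rewrite s0 !gt_eqF.
Qed.

Lemma sqr_lil_slope t : expR (expR 1) <= t -> lil_slope t ^+ 2 * t = ln (ln t).
Proof.
move=> et; have [h1 h2 h3] := lnlnT_ge1 et.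
have t0 : 0 < t by exact: lt_le_trans h3.
rewrite /lil_slope sqr_sqrtr ?divfK ?gt_eqF// divr_ge0 ?(ltW t0)//.
exact: le_trans h1.
Qed.

Lemma lil_slope_le1 t : expR (expR 1) <= t -> lil_slope t <= 1.
Proof.
move=> et; have [h1 h2 h3] := lnlnT_ge1 et.
have t0 : 0 < t by exact: lt_le_trans h3.
rewrite -[leRHS]sqrtr1 ler_wsqrtr// ler_pdivrMr// mul1r.
by rewrite (le_trans (ln_le_id _))// ?ln_le_id// (lt_le_trans _ h2).
Qed.

(** The quotient [ln (ln t) / lil_env t] is exactly [lil_slope t / sqrt 2]; the correction
    [(ln t)^-1] is at most 1, hence at most [e * ln (ln t)]. *)
Lemma lil_env_deriv_bounds t (e : R) : expR (expR 1) <= t ->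
  0 < e -> e^-1 <= ln (ln t) ->
  0 <= lil_env_deriv t <= (1 + e) * (lil_slope t / Num.sqrt 2).
Proof.
move=> et e0 elt; have [h1 h2 h3] := lnlnT_ge1 et.
have t0 : 0 < t by exact: lt_le_trans h3.
have l0 : 0 < ln t by exact: lt_le_trans h2.
have u0 := lil_slope_gt0 et.
have s20 : 0 < Num.sqrt (2 : R) by rewrite sqrtr_gt0.
have EE : lil_env t = Num.sqrt 2 * lil_slope t * t.
  by rewrite -lil_env_slope// divfK// gt_eqF.
have E0 : 0 < lil_env t by rewrite EE !mulr_gt0.
have ll0 : 0 <= ln (ln t) by exact: le_trans h1.
rewrite /lil_env_deriv divr_ge0 ?(ltW E0) ?addr_ge0 ?invr_ge0 ?(ltW l0)//=.
rewrite ler_pdivrMr// EE.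
have -> : (1 + e) * (lil_slope t / Num.sqrt 2) * (Num.sqrt 2 * lil_slope t * t) =
    (1 + e) * (lil_slope t ^+ 2 * t) by field; rewrite gt_eqF.
rewrite sqr_lil_slope// mulrDl mul1r lerD2l.
have : (ln t)^-1 <= 1 by rewrite invf_le1.
have : 1 <= e * ln (ln t) by rewrite -(ler_pM2l e0) divff ?gt_eqF// in elt.
by move=> a b; exact: le_trans b a.
Qed.

End lil_env_derivative.

(* The affine majorant [r + K t] costs a constant on the initial interval, and
   [(1 + e) lil_env] has slope at most [(1 + e)^2 lil_slope / sqrt 2] after it. *)
Lemma lil_majorant {R : realType} (w : R -> R) (r e M1 : R) : 0 < r -> 0 < e -> 0 < M1 ->
  w 0 = 0 -> {within `[0, +oo[, continuous w} ->
  (\forall T \near +oo, w T <= (1 + e) * lil_env T) ->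
  exists (t0 K : R) (dB B : R -> R), [/\ M1 <= t0, 0 <= K,
    (forall t, t0 <= t -> is_derive t 1 B (dB t)),
    (forall t, t0 <= t -> 0 <= dB t <= (1 + e) ^+ 2 / Num.sqrt 2 * lil_slope t) &
    forall t, 0 <= t -> w t <= majorant r K t0 B t].
Proof.
move=> r0 e0 M10 w0 cw [M2 [_ wM2]].
pose t0 := Num.max M1 (Num.max (M2 + 1) (Num.max (expR (expR 1)) (expR (expR e^-1)))).
have t0P t : t0 <= t -> [/\ M2 < t, expR (expR 1) <= t & e^-1 <= ln (ln t)].
  rewrite /t0 !ge_max => /and4P[h1 h2 h3 h4]; split => //; last exact: lnln_ge.
  by rewrite (lt_le_trans _ h2)// ltrDl.
have [_ e1t0 _] := t0P _ (lexx t0).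
have t00 : 0 < t0 by rewrite (lt_le_trans _ e1t0)// expR_gt0.
have [d d0 wd] : exists2 d, 0 < d & forall t, 0 <= t <= d -> w t <= r.
  have [_ w0r] := (continuous_within_itvcyP 0 w).1 cw.
  have : \forall t \near (0 : R)^'+, w t < r by apply: cvgr_lt w0r _ _; rewrite w0.
  rewrite /at_right near_withinE -filter_from_ballE => -[d /= d0 dr].
  exists (d / 2); first by rewrite divr_gt0.
  move=> t /andP[]; rewrite le_eqVlt => /predU1P[<- _|t0' td]; first by rewrite w0 ltW.
  apply/ltW/dr => //; rewrite /ball/= sub0r normrN gtr0_norm//.
  by rewrite (le_lt_trans td)// ltr_pdivrMr// ltr_pMr// ltr1n.
have [Mw wMw] : exists Mw, forall t, 0 <= t <= t0 -> w t <= Mw.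
  have cw0 : {within `[0, t0], continuous w}.
    apply: continuous_subspaceW cw => t /=; rewrite !in_itv/= andbT.
    by move=> /andP[].
  have [c _ cmax] := EVT_max (ltW t00) cw0.
  by exists (w c) => t tt; apply: cmax; rewrite in_itv.
pose B t := (1 + e) * lil_env t.
have B0 : 0 <= B t0 by rewrite mulr_ge0 ?sqrtr_ge0// addr_ge0// ltW.
(* On [[0, d]] the initial height [r] suffices. Beyond [d] the line must exceed the path's maximum
   on [[0, t0]], and at [t0] it must also exceed [B t0] so that the translate stays above [B]. *)
pose K := (`|Mw| + B t0) / Num.min d t0.
have m0 : 0 < Num.min d t0 by rewrite lt_min d0.
have K0 : 0 <= K by rewrite divr_ge0 ?(ltW m0)// addr_ge0.
have Kt t : Num.min d t0 <= t -> `|Mw| + B t0 <= K * t.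
  move=> mt; rewrite /K mulrAC ler_pdivlMr// ler_wpM2l// addr_ge0//.
exists t0, K, (fun t => (1 + e) * lil_env_deriv t), B; split => //.
- by rewrite /t0 le_max lexx.
- move=> t /t0P[_ et _]; have := is_derive_lil_env et => dE.
  have dB : is_derive t 1 ((1 + e) \*: @lil_env R) ((1 + e) *: lil_env_deriv t).
    exact: is_deriveZ.
  exact: dB.
- move=> t /t0P[_ et elt]; have /andP[h1 h2] := lil_env_deriv_bounds et e0 elt.
  rewrite mulr_ge0//=; last by rewrite addr_ge0// ltW.
  apply: (@le_trans _ _ ((1 + e) * ((1 + e) * (lil_slope t / Num.sqrt 2)))).
    by rewrite ler_wpM2l// addr_ge0// ltW.
  by rewrite le_eqVlt; apply/orP; left; apply/eqP; ring.
- move=> t tge0; have [tt0|tt0] := leP t t0; last first.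
    rewrite majorant_right; last exact: ltW.
    have [M2t _ _] := t0P _ (ltW tt0).
    have := wM2 _ M2t; rewrite -/(B t).
    have := Kt t0; rewrite ge_min lexx orbT => /(_ erefl).
    have := normr_ge0 Mw; lra.
  rewrite majorant_left//; have [td|dt] := leP t d.
    by rewrite (le_trans (wd t _)) ?tge0// lerDl mulr_ge0.
  have := wMw t; rewrite tge0 tt0 => /(_ erefl).
  have := Kt t; rewrite ge_min (ltW dt) => /(_ erefl).
  have := ler_norm Mw; lra.
Qed.

(** * Upper bound on the minimal energy *)

Section deterministic_upper_bound.
Context {R : realType}.
Variables (psi theta : R -> R) (kappa : R).
Hypothesis psi_ge0 : forall u : R, 0 <= psi u.
Hypothesis psi_cvx : convex_function [set: R^o] (psi : R^o -> R^o).
Hypothesis kappa_bounds : 1 <= kappa < 2.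
Hypothesis psi_eq : forall u : R, 0 < u -> psi u = u `^ kappa * theta u.
Hypothesis theta_sv : slowly_varying_at0 theta.

(** As [kappa <= 2], four factors [1 + e] give the weak inequality; the fifth buys the strict one
    assumed in [psi_growth]. *)
Lemma lil_slope_constant (e : R) : 0 < e ->
  ((1 + e) ^+ 2 / Num.sqrt 2) `^ kappa < 2 `^ (- (kappa / 2)) * (1 + e) ^+ 5.
Proof.
move=> e0; have [k1 k2] := andP kappa_bounds.
have e10 : 0 < 1 + e by rewrite addr_gt0.
have e11 : 1 < 1 + e by rewrite ltrDl.
have s20 : 0 < Num.sqrt (2 : R) by rewrite sqrtr_gt0.
rewrite powRM ?invr_ge0 ?exprn_ge0 ?(ltW e10) ?(ltW s20)//.
have -> : (Num.sqrt 2)^-1 `^ kappa = 2 `^ (- (kappa / 2)) :> R.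
  by rewrite -powR12_sqrt// -powRN -powRrM; congr (_ `^ _); field.
rewrite mulrC ltr_pM2l ?powR_gt0//.
rewrite (@le_lt_trans _ _ (((1 + e) ^+ 2) `^ 2%:R))//.
  by rewrite ler_powR ?exprn_ege1// ltW.
rewrite powR_mulrn ?exprn_ge0 ?(ltW e10)// -exprM.
by rewrite ltr_eXn2l.
Qed.

(** Regular variation removes [lam] at the price [q]. Then the Potter bound applies with ratio
    [sqrt (T / s)], because [ln (ln s) <= ln (ln T)] gives [lil_slope s <= sqrt (T / s) * lil_slope
    T]. *)
Lemma psi_growth (lam q e p : R) : 0 < lam -> lam `^ kappa < q ->
  0 < e -> kappa < p -> p < 2 -> exists2 t1 : R, 0 < t1 &
  forall s T l, t1 <= s -> s <= T -> 0 <= l -> l <= lam * lil_slope s ->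
  psi l <= q * (1 + e) ^+ 2 * psi (lil_slope T) *
           (T `^ (p / 2) * s `^ (- (p / 2))).
Proof.
move=> lam0 lamk e0 kp p2; have [k1 k2] := andP kappa_bounds.
have q0 : 0 < q by apply: lt_trans lamk; rewrite powR_gt0.
have e10 : 0 < 1 + e by rewrite addr_gt0.
have e11 : 1 < 1 + e by rewrite ltrDl.
have [u0 u00 pot] := psi_potter psi_ge0 psi_cvx k1 psi_eq theta_sv kp e11.
have near1 : \forall u \near (0 : R)^'+, u < u0 /\ psi (lam * u) <= q * psi u.
  apply: filterS2 (nbhs_right_lt u00) (psi_ratio_le psi_eq theta_sv lam0 lamk).
  by move=> u ? ?; split.
have [M [_ HM]] := near_lil_slope near1.
exists (Num.max (M + 1) (expR (expR 1))); first by rewrite lt_max expR_gt0 orbT.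
move=> s T l; rewrite ge_max => /andP[Ms es] sT l0 ll.
have MT x : s <= x -> M < x.
  by move=> sx; rewrite (lt_le_trans _ sx)// (lt_le_trans _ Ms)// ltrDl.
have [us rs] := HM _ (MT _ (lexx s)); have [uT _] := HM _ (MT _ sT).
have eT := le_trans es sT.
have us0 := lil_slope_gt0 es; have uT0 := lil_slope_gt0 eT.
have [a1 a2 a3] := lnlnT_ge1 es; have [b1 b2 b3] := lnlnT_ge1 eT.
have s0 : 0 < s by exact: lt_le_trans a3.
have T0 : 0 < T by exact: lt_le_trans b3.
have h1 := psi_nd psi_ge0 psi_cvx k1 psi_eq theta_sv l0 ll.
apply: (le_trans h1); apply: (le_trans rs).
have r1 : 1 <= Num.sqrt (T / s) by rewrite -[leLHS]sqrtr1 ler_wsqrtr// ler_pdivlMr// mul1r.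
have ur : lil_slope s <= Num.sqrt (T / s) * lil_slope T.
  have Ts0 : 0 <= T / s by rewrite divr_ge0// ltW.
  rewrite /lil_slope -sqrtrM// ler_wsqrtr//.
  have -> : T / s * (ln (ln T) / T) = ln (ln T) / s by field; rewrite !gt_eqF.
  by rewrite ler_pM2r ?invr_gt0// lnln_mono.
have := pot (lil_slope s) (lil_slope T) _ _ _ r1 ur.
rewrite us0 us uT0 uT => /(_ erefl erefl) h2.
have -> : q * (1 + e) ^+ 2 * psi (lil_slope T) * (T `^ (p / 2) * s `^ (- (p / 2))) =
  q * ((1 + e) ^+ 2 * (T `^ (p / 2) * s `^ (- (p / 2))) * psi (lil_slope T)).
  by ring.
rewrite ler_pM2l//; apply: (le_trans h2).
rewrite ler_wpM2r// powRM ?(ltW e10) ?sqrtr_ge0//.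
have -> : Num.sqrt (T / s) `^ p = T `^ (p / 2) * s `^ (- (p / 2)).
  rewrite -powR12_sqrt ?divr_ge0 ?(ltW T0) ?(ltW s0)// -powRrM [2^-1 * p]mulrC.
  rewrite powRM ?invr_ge0 ?(ltW T0) ?(ltW s0)//; congr (_ * _).
  by rewrite -(powR_inv1 (ltW s0)) -powRrM mulN1r.
rewrite ler_wpM2r ?mulr_ge0 ?powR_ge0// -powR_mulrn ?(ltW e10)//.
by apply: ler_powR; exact: ltW.
Qed.

(** The seven factors [1 + e] are the five of [lil_slope_constant] and the two of [psi_growth]. *)
Lemma upper_constant_approx (c : R) :
  2 `^ (- (kappa / 2)) / (1 - kappa / 2) < c ->
  exists e, [/\ 0 < e, kappa + e < 2 &
    2 `^ (- (kappa / 2)) * (1 + e) ^+ 7 / (1 - (kappa + e) / 2) < c].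
Proof.
have [k1 k2] := andP kappa_bounds; set A := 2 `^ (- (kappa / 2)) => Ac.
have A0 : 0 < A by rewrite powR_gt0.
have D0 : 0 < 1 - kappa / 2 by lra.
have c0 : 0 < c by apply: lt_trans Ac; rewrite divr_gt0.
move: Ac; rewrite ltr_pdivrMr// => Ac.
set g := c * (1 - kappa / 2) - A; have g0 : 0 < g by rewrite subr_gt0.
(* For [e <= 1] the power is at most [1 + 512 * e], and the denominator loses [e / 2]; both errors
   together are at most [e * m]. *)
pose m := c + 512 * A; have m0 : 0 < m by rewrite /m; lra.
pose e := Num.min (1 - kappa / 2) (Num.min 1 (g / m / 2)).
have e0 : 0 < e by rewrite !lt_min D0 ltr01 !divr_gt0.
have eD : e <= 1 - kappa / 2 by rewrite /e ge_min lexx.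
have e1 : e <= 1 by rewrite /e !ge_min lexx !orbT.
have em : e * m < g.
  rewrite -ltr_pdivlMr// (@le_lt_trans _ _ (g / m / 2))//.
    by rewrite /e !ge_min lexx !orbT.
  by rewrite ltr_pdivrMr// ltr_pMr ?divr_gt0// ltr1n.
exists e; split => //; first by lra.
have D'0 : 0 < 1 - (kappa + e) / 2 by lra.
rewrite ltr_pdivrMr//.
have p7 : (1 + e) ^+ 7 <= 1 + 512 * e.
  have h2 : (1 + e) ^+ 2 <= 1 + 3 * e by nra.
  have h4 : (1 + e) ^+ 4 <= 1 + 15 * e.
    rewrite (exprM _ 2 2) (@le_trans _ _ ((1 + 3 * e) ^+ 2))//; last by nra.
    by rewrite ler_pXn2r// ?nnegrE ?exprn_ge0//; lra.
  have h8 : (1 + e) ^+ 8 <= 1 + 512 * e.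
    rewrite (exprM _ 4 2) (@le_trans _ _ ((1 + 15 * e) ^+ 2))//; last by nra.
    by rewrite ler_pXn2r// ?nnegrE ?exprn_ge0//; lra.
  by apply: le_trans h8; apply: ler_weXn2l => //; lra.
apply: (@le_lt_trans _ _ (A * (1 + 512 * e))); first by rewrite ler_pM2l.
by move: em; rewrite /m /g; nra.
Qed.

Lemma normalized_min_energy_le (w : R -> R) (r c : R) : 0 < r ->
  2 `^ (- (kappa / 2)) / (1 - kappa / 2) < c ->
  w 0 = 0 -> {within `[0, +oo[, continuous w} ->
  (forall e, 0 < e -> \forall T \near +oo, w T <= (1 + e) * lil_env T) ->
  \forall T \near +oo,
    (min_energy psi w T r * ((T * psi (lil_slope T))^-1)%:E <= c%:E)%E.
Proof.
move=> r0 Kc w0 cw lil; have [k1 k2] := andP kappa_bounds.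
have [e [e0 ke2 Ke]] := upper_constant_approx Kc.
set A := 2 `^ (- (kappa / 2)) in Ke; have A0 : 0 < A by rewrite powR_gt0.
set p := kappa + e in ke2 Ke; have kp : kappa < p by rewrite ltrDl.
pose lam := (1 + e) ^+ 2 / Num.sqrt 2.
have lam0 : 0 < lam by rewrite divr_gt0 ?sqrtr_gt0// exprn_gt0// addr_gt0.
have [t1 t10 growth] := psi_growth lam0 (lil_slope_constant e0) e0 kp ke2.
(* This second use of [psi_growth], with factor 1 and the crude constant 2, serves only to bound the
   normalization from below. *)
have one_lt2 : (1 : R) `^ kappa < 2 by rewrite powR1 ltr1n.
have [t2 t20 growth1] := psi_growth ltr01 one_lt2 e0 kp ke2.
have [M [_ psiM]] := near_lil_slope (psi_gt0 psi_eq theta_sv).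
pose M1 := Num.max t1 (Num.max t2 (Num.max (M + 1) (expR (expR 1)))).
have M10 : 0 < M1 by rewrite lt_max t10.
have [t0 [K [dB [B [t0M K0 BdB dBle wh]]]]] := lil_majorant r0 e0 M10 w0 cw (lil e e0).
have t0P s : t0 <= s -> [/\ t1 <= s, t2 <= s, M < s & expR (expR 1) <= s].
  move=> ts; have := le_trans t0M ts; rewrite /M1 !ge_max => /and4P[h1 h2 h3 h4].
  by split => //; rewrite (lt_le_trans _ h3)// ltrDl.
have t00 : 0 < t0 by exact: lt_le_trans t0M.
set b := p / 2; have b1 : b < 1 by rewrite /b; lra.
have b10 : 0 < 1 - b by rewrite subr_gt0.
set h := majorant r K t0 B.
set C0 := Num.max (psi K) (psi (derive1 h t0)).
have C00 : 0 <= C0 by rewrite le_max psi_ge0.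
have dB_bnd s : t0 <= s -> 0 <= dB s <= lam.
  move=> ts; have /andP[-> h2] := dBle _ ts; have [_ _ _ es] := t0P _ ts.
  by rewrite (le_trans h2)// ler_piMr ?(ltW lam0)// lil_slope_le1.
(* This slack has to absorb the fixed cost [C0 * t0] once [T] is large. *)
pose eta := c - A * (1 + e) ^+ 7 / (1 - b).
have eta0 : 0 < eta by rewrite subr_gt0.
(* [T psi (lil_slope T)] tends to infinity, by the growth bound between [t0] and [T]. *)
have [_ t2t0 Mt0 et0] := t0P _ (lexx t0).
have q0 : 0 < 2 * (1 + e) ^+ 2 by rewrite mulr_gt0// exprn_gt0// addr_gt0.
have pt0 : 0 < psi (lil_slope t0) by exact: psiM.
pose k0 := psi (lil_slope t0) / (2 * (1 + e) ^+ 2) * t0 `^ b.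
have k00 : 0 < k0 by rewrite mulr_gt0 ?divr_gt0// powR_gt0.
have lower_growth T : t0 <= T -> k0 * T `^ (1 - b) <= T * psi (lil_slope T).
  move=> tT; have T0 : 0 < T by exact: lt_le_trans tT.
  have slt0 : 0 < lil_slope t0 by exact: lil_slope_gt0.
  have := growth1 t0 T (lil_slope t0) t2t0 tT (ltW slt0); rewrite mul1r => /(_ (lexx _)).
  rewrite -/b -(ler_pM2l (powR_gt0 (1 - b) T0)) => h1.
  have TT : T `^ (1 - b) * T `^ b = T.
    by rewrite -powRD ?subrK ?powRr1 ?(ltW T0)// gt_eqF// implybT.
  have tt : t0 `^ (- b) * t0 `^ b = 1.
    by rewrite powRN mulVf// gt_eqF// powR_gt0.
  have -> : k0 * T `^ (1 - b) =
      (T `^ (1 - b) * psi (lil_slope t0)) * (t0 `^ b / (2 * (1 + e) ^+ 2)).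
    by rewrite /k0; field; rewrite !gt_eqF// addr_gt0.
  apply: (@le_trans _ _ (T `^ (1 - b) * (2 * (1 + e) ^+ 2 * psi (lil_slope T) *
      (T `^ b * t0 `^ (- b))) * (t0 `^ b / (2 * (1 + e) ^+ 2)))).
    by rewrite ler_pM2r// divr_gt0// powR_gt0.
  rewrite le_eqVlt; apply/orP; left; apply/eqP.
  transitivity (T `^ (1 - b) * T `^ b * psi (lil_slope T) * (t0 `^ (- b) * t0 `^ b)).
    by field; rewrite !gt_eqF// addr_gt0.
  by rewrite TT tt mulr1.
pose X := C0 * t0 / (eta * k0).
have ek0 : 0 < eta * k0 by rewrite mulr_gt0.
have X0 : 0 <= X by rewrite divr_ge0 ?(ltW ek0)// mulr_ge0// ltW.
near=> T; have tT : t0 < T.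
  by near: T; apply: nbhs_pinfty_gt; exact: num_real.
have [t1T _ MT eT] := t0P _ (ltW tT).
have T0 : 0 < T by exact: lt_trans tT.
have pT : 0 < psi (lil_slope T) by exact: psiM.
have C0T : C0 * t0 <= eta * (T * psi (lil_slope T)).
  apply: (@le_trans _ _ (eta * (k0 * T `^ (1 - b)))); last first.
    by rewrite ler_pM2l// lower_growth// ltW.
  have -> : C0 * t0 = X * (eta * k0) by rewrite divfK ?gt_eqF.
  rewrite mulrA [leRHS]mulrC ler_pM2r//.
  have XT : (1 + X) `^ (1 - b)^-1 <= T.
    by near: T; apply: nbhs_pinfty_ge; exact: num_real.
  apply: (@le_trans _ _ (1 + X)); first by rewrite lerDr.
  have -> : 1 + X = ((1 + X) `^ (1 - b)^-1) `^ (1 - b).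
    by rewrite -powRrM mulVf ?gt_eqF// powRr1// addr_ge0.
  by rewrite ge0_ler_powR ?nnegrE ?powR_ge0 ?(ltW b10) ?(ltW T0).
have energy_le : (min_energy psi w T r <= (C0 * t0 +
    (A * (1 + e) ^+ 7 * psi (lil_slope T) * T `^ b) * (T `^ (1 - b) / (1 - b)))%:E)%E.
  apply: (@le_trans _ _ (psi_energy psi T h)).
    apply: ge_ereal_inf; exists (psi_energy psi T h) => //; exists h => //; split.
    - exact: (majorant_ac _ K0 BdB dB_bnd).
    - by rewrite /h majorant_left ?(ltW t00)// mulr0 addr0.
    - by move=> t /andP[? _]; exact: wh.
  apply: majorant_energy => //.
    by rewrite !mulr_ge0 ?powR_ge0// ?exprn_ge0 ?addr_ge0 ?(ltW e0).
  move=> s t0s sT; have /andP[d0 dle] := dBle _ (ltW t0s).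
  have [t1s _ _ _] := t0P _ (ltW t0s).
  have := growth s T (dB s) t1s (ltW sT) d0 dle; rewrite -/A -/b => /le_trans; apply.
  by rewrite le_eqVlt; apply/orP; left; apply/eqP; ring.
rewrite lee_pdivrMr ?mulr_gt0// -EFinM (le_trans energy_le)// lee_fin.
have TT : T `^ b * T `^ (1 - b) = T.
  rewrite -powRD; last by rewrite (gt_eqF T0) implybT.
  by rewrite addrC subrK powRr1// ltW.
have -> : (A * (1 + e) ^+ 7 * psi (lil_slope T) * T `^ b) * (T `^ (1 - b) / (1 - b)) =
    A * (1 + e) ^+ 7 / (1 - b) * (T * psi (lil_slope T)).
  transitivity (A * (1 + e) ^+ 7 / (1 - b) *
    (T `^ b * T `^ (1 - b) * psi (lil_slope T))); [by ring|by rewrite TT].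
by move: C0T; rewrite /eta mulrBl; lra.
Unshelve. all: by end_near. Qed.

End deterministic_upper_bound.

(** * The law of the iterated logarithm *)

Section gaussian_tails.
Context {R : realType}.
Notation mu := (@lebesgue_measure R).

(* On the side of [0] beyond [a], the centred density is at most
   [exp (- a^2 / 2 s^2)] times the density centred at [a]. *)
Lemma normal_tail_shift (s a : R) (A : set R) : 0 < s -> measurable A ->
  (forall x, A x -> a ^+ 2 <= a * x) ->
  (normal_prob 0 s A <= (expR (- (a / s) ^+ 2 / 2))%:E)%E.
Proof.
move=> s0 mA Aa; have sn0 : s != 0 by rewrite gt_eqF.
rewrite /normal_prob.
have mpdf m : measurable_fun A (fun x => (normal_pdf m s x)%:E).
  apply/measurable_EFinP; apply: measurable_funTS; exact: measurable_normal_pdf.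
apply: (@le_trans _ _ (\int[mu]_(x in A)
    ((expR (- (a / s) ^+ 2 / 2))%:E * (normal_pdf a s x)%:E))%E).
  apply: ge0_le_integral => //.
  - by move=> x _; rewrite lee_fin normal_pdf_ge0.
  - exact: mpdf.
  - by apply: emeasurable_funM => //; exact: mpdf.
  move=> x Ax; rewrite -EFinM lee_fin !normal_pdfE// mulrCA.
  rewrite ler_wpM2l ?normal_peak_ge0// /normal_fun -expRD ler_expR.
  rewrite -subr_ge0.
  have -> : - (a / s) ^+ 2 / 2 + - (x - a) ^+ 2 / (s ^+ 2 *+ 2) -
     (- (x - 0) ^+ 2 / (s ^+ 2 *+ 2)) = (a * x - a ^+ 2) / s ^+ 2.
    by rewrite -mulr_natr; field.
  by rewrite divr_ge0 ?subr_ge0 ?Aa// sqr_ge0.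
rewrite ge0_integralZl//; first last.
- by move=> x _; rewrite lee_fin normal_pdf_ge0.
- exact: mpdf.
rewrite -[leRHS]mule1 lee_wpmul2l ?lee_fin ?expR_ge0//.
have := probability_le1 (normal_prob a s) mA; exact.
Qed.

Lemma normal_upper_tail_le (s a : R) : 0 < s -> 0 <= a ->
  (normal_prob 0 s `[a, +oo[%classic <= (expR (- (a / s) ^+ 2 / 2))%:E)%E.
Proof.
move=> s0 a0; apply: normal_tail_shift => //.
by move=> x; rewrite /= in_itv/= andbT expr2 => ax; rewrite ler_wpM2l.
Qed.

Lemma normal_lower_tail_le (s a : R) : 0 < s -> 0 <= a ->
  (normal_prob 0 s `]-oo, (- a)%R]%classic <= (expR (- (a / s) ^+ 2 / 2))%:E)%E.
Proof.
move=> s0 a0; have := @normal_tail_shift s (- a) `]-oo, (- a)]%classic s0.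
have -> : (- a / s) ^+ 2 = (a / s) ^+ 2 by rewrite mulNr sqrrN.
apply => //.
by move=> x; rewrite /= in_itv/= => ax; rewrite sqrrN mulNr -mulrN expr2 ler_wpM2l// lerNr.
Qed.

(** Only [[a, a + s]] is kept, where the density is smallest at the right end; the length [s] turns
    [normal_peak s] into [normal_peak 1]. *)
Lemma normal_upper_tail_ge (s a : R) : 0 < s -> 0 <= a ->
  ((normal_peak 1 * expR (- (a / s + 1) ^+ 2 / 2))%:E <=
   normal_prob 0 s `[a, +oo[%classic)%E.
Proof.
move=> s0 a0; have sn0 : s != 0 by rewrite gt_eqF.
pose c := normal_peak s * expR (- (a / s + 1) ^+ 2 / 2).
have mas : measurable (`[a, (a + s)%R] : set R) by exact: measurable_itv.
have aas : a < a + s by rewrite ltrDl.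
apply: (@le_trans _ _ (normal_prob 0 s `[a, (a + s)%R]%classic)); last first.
  rewrite le_measure ?inE//; apply: subset_itvl => //.
rewrite /normal_prob.
apply: (@le_trans _ _ (\int[mu]_(x in `[a, (a + s)%R]) c%:E)%E).
  have muI : mu `[a, (a + s)%R]%classic = s%:E.
    by rewrite lebesgue_measure_itv/= lte_fin aas -EFinD addrC addKr.
  rewrite integral_cst// [X in (_ * X)%E](_ : _ = s%:E)// -EFinM lee_fin /c mulrAC.
  rewrite ler_wpM2r ?expR_ge0// /normal_peak expr1n mul1r -mulrnAr sqrtrM ?sqr_ge0//.
  by rewrite sqrtr_sqr gtr0_norm// invfM mulrAC mulVf// mul1r.
apply: ge0_le_integral => //.
- by move=> x _; rewrite lee_fin mulr_ge0 ?normal_peak_ge0 ?expR_ge0.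
- apply/measurable_EFinP; apply: measurable_funTS; exact: measurable_normal_pdf.
move=> x; rewrite /= in_itv/= => /andP[ax xas].
rewrite lee_fin normal_pdfE// /c ler_wpM2l ?normal_peak_ge0// /normal_fun ler_expR.
have s22 : s ^+ 2 *+ 2 = s ^+ 2 * 2 by rewrite mulr_natr.
rewrite subr0 s22 mulNr [leRHS]mulNr lerN2 ler_pdivrMr; last first.
  by rewrite mulr_gt0// exprn_gt0.
have -> : (a / s + 1) ^+ 2 / 2 * (s ^+ 2 * 2) = (a + s) ^+ 2 by field.
have x0 : 0 <= x by exact: le_trans ax.
have as0 : 0 <= a + s by exact: le_trans xas.
by rewrite ler_pXn2r ?nnegrE.
Qed.

End gaussian_tails.

(** * The two Borel-Cantelli lemmas *)

Section borel_cantelli.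
Context {R : realType} {d : measure_display} {Omega : measurableType d}.
Variable P : probability Omega R.

Lemma borel_cantelli_bounded (A : nat -> set Omega) (p : nat -> R) (N : nat) (M : R) :
  (forall n, measurable (A n)) ->
  (forall n, (N <= n)%N -> (P (A n) <= (p n)%:E)%E) ->
  (forall n, \sum_(N <= i < n) p i <= M) ->
  {ae P, forall w, \forall n \near \oo, ~ A n w}.
Proof.
move=> mA Ap pM; pose B n := A (n + N)%N.
have B0 : P (lim_sup_set B) = 0%E.
  apply: lim_sup_set_cvg0; first by move=> n; exact: mA.
  apply: (@le_lt_trans _ _ M%:E); last exact: ltry.
  apply: lime_le; first exact: is_cvg_nneseries.
  apply: nearW => n; rewrite (le_trans _ (_ : (\sum_(N <= i < n + N) p i)%:E <= _)%E)//.
    rewrite -{1}[N]add0n big_addn addnK -sumEFin; apply: lee_sum => i _.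
    by apply: Ap; rewrite leq_addl.
  by rewrite lee_fin.
exists (lim_sup_set B); split => //.
  by apply: bigcapT_measurable => n; apply: bigcup_measurable => k _; exact: mA.
move=> w /= wA; apply: contrapT => wB; apply: wA.
have [n0 nB] : exists n0, forall n, (n0 <= n)%N -> ~ B n w.
  apply: contrapT => nex; apply: wB => n _; apply: contrapT => nB; apply: nex.
  by exists n => m nm Bm; apply: nB; exists m.
exists (n0 + N)%N => // n /= n0n Anw; apply: (nB (n - N)%N).
  by rewrite leq_subRL ?(leq_trans _ n0n)// ?leq_addl// addnC.
by rewrite /B subnK// (leq_trans _ n0n)// leq_addl.
Qed.

(* [P (no A i for N <= i < n) <= exp (- c sum_(N <= i < n) 1 / (i + 1))]. *)
Lemma independent_borel_cantelli (X : nat -> Omega -> R) (A : nat -> set R) (c : R)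
    (N0 : nat) :
  (forall i, measurable_fun setT (X i)) -> (forall i, measurable (A i)) ->
  (forall n, mutually_independent P (fun i : 'I_n => X i)) -> 0 < c ->
  (forall i, (N0 <= i)%N -> ((c / i.+1%:R)%:E <= P (X i @^-1` A i))%E) ->
  {ae P, forall w, forall N, exists2 n, (N <= n)%N & A n (X n w)}.
Proof.
move=> mX mA indX c0 PA.
have mXA i (B : set R) : measurable B -> measurable (X i @^-1` B).
  by move=> mB; rewrite -[X in measurable X]setTI; exact: mX.
apply/ae_foralln => N.
pose N1 := maxn N N0.
pose F n := \bigcap_(i in [set i | (N1 <= i < n)%N]) X i @^-1` ~` A i.
have mF n : measurable (F n).
  by apply: bigcap_measurableType => i _; apply: mXA; exact: measurableC.
have PF n : (P (F n) <= (expR (- (c * \sum_(N1 <= i < n) i.+1%:R^-1)))%:E)%E.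
  pose J : {set 'I_n} := [set i : 'I_n | (N1 <= i)%N]%SET.
  have -> : F n = \bigcap_(i in [set` J]) X i @^-1` ~` A i.
    apply/seteqP; split => w wF i /=; first by rewrite inE => Ni; apply: wF; rewrite /= Ni/=.
    by move=> /andP[Ni ni]; apply: (wF (Ordinal ni)); rewrite /= inE.
  have := indX n J (fun i => ~` A i); rewrite /mutually_independent => ->; last first.
    by move=> i; exact: measurableC.
  have -> : expR (- (c * \sum_(N1 <= i < n) i.+1%:R^-1)) =
      \prod_(i in J) expR (- (c / i.+1%:R)).
    rewrite -expR_sum; congr expR; rewrite sumrN -mulr_sumr; congr (- (_ * _)).
    rewrite big_geq_mkord.
    by apply: eq_bigl => i; rewrite inE.
  rewrite -prodEFin.
  (* Nonnegativity of the partial products is carried along, since multiplying inequalities of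
     extended reals needs it. *)
  apply: (proj2 (andP _)).
  apply: (big_rec2 (fun x y : \bar R => (0 <= x)%E && (x <= y)%E)).
    by rewrite lee_fin ler01 lexx.
  move=> i x y; rewrite inE => Ni /andP[x0 xy].
  rewrite mule_ge0//= lee_pmul// preimage_setC probability_setC; last exact: mXA.
  apply: (@le_trans _ _ (1 - (c / i.+1%:R)%:E)%E).
    by rewrite leeB// PA// (leq_trans _ Ni)// leq_maxr.
  by rewrite -EFinB lee_fin -(opprK (c / _)) expR_ge1Dx.
have harm n : (N1 <= n)%N ->
    ln n.+1%:R - ln N1.+1%:R <= \sum_(N1 <= i < n) i.+1%:R^-1 :> R.
  move=> Nn; rewrite -(telescope_sumr (fun k => ln k.+1%:R) Nn).
  rewrite !big_nat; apply: ler_sum => i _.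
  rewrite -ln_div ?posrE ?ltr0n//.
  have -> : i.+2%:R / i.+1%:R = 1 + i.+1%:R^-1 :> R.
    by rewrite -[in LHS]natr1 mulrDl mul1r divff// pnatr_eq0.
  by apply: le_ln1Dx; rewrite (lt_le_trans (ltrN10 _))// invr_ge0.
exists (\bigcap_n F n); split.
- by apply: bigcapT_measurable.
- apply/eqP; rewrite eq_le measure_ge0 andbT; apply/lee_addgt0Pr => e e0.
  rewrite add0e.
  (* Chosen so that [c * (ln n.+1 - ln N1.+1) >= - ln e], by the logarithmic lower bound on the
     harmonic sum. *)
  pose n := (maxn N1 (Num.trunc (expR (ln N1.+1%:R - ln e / c))).+1).
  have Nn : (N1 <= n)%N by rewrite leq_maxl.
  apply: (@le_trans _ _ (P (F n))).
    rewrite le_measure ?inE//; first exact: bigcapT_measurable.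
    by move=> w /(_ n I).
  apply: (le_trans (PF n)); rewrite lee_fin -[leRHS]lnK ?posrE// ler_expR lerNl.
  apply: (@le_trans _ _ (c * (ln n.+1%:R - ln N1.+1%:R))); last first.
    by rewrite ler_pM2l// harm.
  rewrite mulrC -ler_pdivrMr// mulNr lerBrDl.
  rewrite -ler_expR lnK ?posrE ?ltr0n//.
  apply/ltW/(lt_le_trans (truncnS_gt _)).
  by rewrite ler_nat ltnW// ltnS leq_maxr.
- move=> w /= nw n _ i /= /andP[N1i _] /= Aiw; apply: nw; exists i => //.
  by rewrite (leq_trans _ N1i)// leq_maxl.
Qed.

End borel_cantelli.

Section wiener_tails.
Context {R : realType} {d : measure_display} {Omega : measurableType d}.
Variables (P : probability Omega R) (W : R -> {RV P >-> R}).
Hypothesis W_wiener : standard_wiener W.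

Lemma measurable_increment (s t : R) : measurable_fun setT (fun w => W t w - W s w).
Proof. by apply: measurable_funB; exact: measurable_funPT. Qed.

Lemma measurable_increment_set (s t : R) (B : set R) : measurable B ->
  measurable [set w | B (W t w - W s w)].
Proof.
move=> mB; have := measurable_increment s t measurableT mB.
by rewrite setTI.
Qed.

Lemma measurable_increment_ge (s t y : R) : measurable [set w | y <= W t w - W s w].
Proof.
have -> : [set w | y <= W t w - W s w] = [set w | `[y, +oo[%classic (W t w - W s w)].
  by apply/seteqP; split => w /=; rewrite in_itv/= andbT.
apply: measurable_increment_set; exact: measurable_itv.
Qed.

Lemma measurable_increment_le (s t y : R) : measurable [set w | W t w - W s w <= y].
Proof.
have -> : [set w | W t w - W s w <= y] = [set w | `]-oo, y]%classic (W t w - W s w)].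
  by apply/seteqP; split => w /=; rewrite in_itv/=.
apply: measurable_increment_set; exact: measurable_itv.
Qed.

Section increment.
Variables (s t x : R).
Hypotheses (s0 : 0 <= s) (st : s < t) (x0 : 0 <= x).

Let sd0 : 0 < Num.sqrt (t - s).
Proof. by rewrite sqrtr_gt0 subr_gt0. Qed.

Let xsd0 : 0 <= x * Num.sqrt (t - s).
Proof. by rewrite mulr_ge0// ltW. Qed.

Lemma wiener_upper_tail_le :
  (P [set w | (x * Num.sqrt (t - s) <= W t w - W s w)%R]
   <= (expR (- x ^+ 2 / 2))%:E)%E.
Proof.
have -> : [set w | x * Num.sqrt (t - s) <= W t w - W s w] =
    [set w | `[(x * Num.sqrt (t - s))%R, +oo[%classic (W t w - W s w)].
  by apply/seteqP; split => w /=; rewrite in_itv/= andbT.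
rewrite (wiener_gaussian_increments W_wiener s0 st); last exact: measurable_itv.
by have := normal_upper_tail_le sd0 xsd0; rewrite mulfK// gt_eqF.
Qed.

Lemma wiener_lower_tail_le :
  (P [set w | (W t w - W s w <= - (x * Num.sqrt (t - s)))%R]
   <= (expR (- x ^+ 2 / 2))%:E)%E.
Proof.
have -> : [set w | W t w - W s w <= - (x * Num.sqrt (t - s))] =
    [set w | `]-oo, (- (x * Num.sqrt (t - s)))%R]%classic (W t w - W s w)].
  by apply/seteqP; split => w /=; rewrite in_itv/=.
rewrite (wiener_gaussian_increments W_wiener s0 st); last exact: measurable_itv.
by have := normal_lower_tail_le sd0 xsd0; rewrite mulfK// gt_eqF.
Qed.

Lemma wiener_upper_tail_ge :
  ((normal_peak 1 * expR (- (x + 1) ^+ 2 / 2))%:E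
   <= P [set w | (x * Num.sqrt (t - s) <= W t w - W s w)%R])%E.
Proof.
have -> : [set w | x * Num.sqrt (t - s) <= W t w - W s w] =
    [set w | `[(x * Num.sqrt (t - s))%R, +oo[%classic (W t w - W s w)].
  by apply/seteqP; split => w /=; rewrite in_itv/= andbT.
rewrite (wiener_gaussian_increments W_wiener s0 st); last exact: measurable_itv.
by have := normal_upper_tail_ge sd0 xsd0; rewrite mulfK// gt_eqF.
Qed.

End increment.

End wiener_tails.

(** * Chaining along dyadic points *)

Section dyadic_chaining.
Context {R : realType}.
Variables (a b y : R) (w : R -> R).
Hypotheses (a0 : 0 <= a) (ab : a < b) (y0 : 0 <= y).
Hypothesis w_cont : {within `[0, +oo[, continuous w}.
Hypothesis w_incr : forall n k, (k < 2 ^ n)%N ->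
  w (dyadic a b n k.+1) - w (dyadic a b n k) <= y * (3 / 4) ^+ n.

(** A point with odd index at level [n.+1] is one increment after a point of level [n], and one with
    even index already belongs to level [n]; each level costs at most one increment. *)
Lemma chaining_dyadic n k : (k <= 2 ^ n)%N ->
  w (dyadic a b n k) - w a <= \sum_(i < n.+1) y * (3 / 4) ^+ i.
Proof.
elim: n k => [|n ih] k kn.
  rewrite big_ord1 expr0 mulr1.
  case: k kn => [|[|//]] _; first by rewrite dyadic0 subrr.
  by have := @w_incr 0%N 0%N erefl; rewrite expr0 mulr1 dyadic0.
have p0 : 0 <= y * (3 / 4) ^+ n.+1 by rewrite mulr_ge0// exprn_ge0// divr_ge0.
have kE := odd_double_half k.
rewrite big_ord_recr/=; move: kE; case: (odd k) => /= kE.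
  have k2 : (k./2 < 2 ^ n)%N.
    by rewrite -ltn_double -[(2 ^ n).*2]mul2n -expnS -[X in (X <= _)%N]add1n kE.
  have h1 := ih _ (ltnW k2).
  have h2 : w (dyadic a b n.+1 k./2.*2.+1) - w (dyadic a b n.+1 k./2.*2) <=
      y * (3 / 4) ^+ n.+1.
    by apply: w_incr; rewrite (leq_trans _ kn)// -add1n kE.
  by rewrite -kE add1n; move: h2; rewrite dyadicS; lra.
have k2 : (k./2 <= 2 ^ n)%N.
  by rewrite -leq_double -[(2 ^ n).*2]mul2n -expnS -{1}[k./2.*2]add0n kE.
by rewrite -kE add0n dyadicS; have := ih _ k2; lra.
Qed.

Lemma chaining_sum n : \sum_(i < n) y * (3 / 4) ^+ i <= 4 * y.
Proof.
suff : \sum_(i < n) y * (3 / 4) ^+ i = 4 * y * (1 - (3 / 4) ^+ n).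
  move=> ->; rewrite ler_piMr ?mulr_ge0// gerBl exprn_ge0//.
elim: n => [|n ih]; first by rewrite big_ord0 expr0 subrr mulr0.
by rewrite big_ord_recr/= ih exprS; field.
Qed.

(** The right ends of the cells containing [t] converge to [t], so continuity extends the dyadic
    bound. *)
Lemma chaining t : a <= t <= b -> w t <= w a + 4 * y.
Proof.
move=> /andP[]; rewrite le_eqVlt => /predU1P[<- _|at_ tb].
  by rewrite lerDl mulr_ge0.
have [cw _] := (continuous_within_itvcyP 0 w).1 w_cont.
have wt : {for t, continuous w}.
  by apply: cw; rewrite in_itv/= andbT (le_lt_trans a0).
apply/ler_addgt0Pr => e e0.
have /cvgrPdist_lt/(_ e e0) : w x @[x --> t] --> w t by exact: wt.
rewrite -filter_from_ballE => -[dl /= dl0 wdl].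
have ba0 : 0 < b - a by rewrite subr_gt0.
near \oo => n.
have ne : (b - a) / 2 ^+ n < dl.
  rewrite ltr_pdivrMr ?exprn_gt0// mulrC -ltr_pdivrMr//.
  rewrite (@lt_le_trans _ _ n%:R)//; first by near: n; exact: nbhs_infty_gtr.
  by rewrite -natrX ler_nat ltnW// ltn_expl.
have atb : a < t <= b by rewrite at_.
have [k k2] := ex_cell n atb.
rewrite /cell /= in_itv/= => /andP[k1 k3].
have dk : dyadic a b n k.+1 = dyadic a b n k + (b - a) / 2 ^+ n.
  by rewrite /dyadic -addrA; congr (_ + _); rewrite -natr1; ring.
have := wdl (dyadic a b n k.+1); rewrite /ball/= => h.
have {}h : `|w t - w (dyadic a b n k.+1)| < e.
  by apply: h; rewrite ltr_norml; apply/andP; split; lra.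
have := chaining_dyadic k2; have := chaining_sum n.+1.
by move: h; rewrite ltr_norml => /andP[_]; lra.
Unshelve. all: by end_near. Qed.

End dyadic_chaining.

(** * Explicit bounds for series *)

Section power_sums.
Context {R : realType}.
Implicit Types (n : nat) (e : R).

(** Integral comparison for the series of n^-(1+e) in telescoping form, from [exp x >= 1 + x] and
    [ln (1 + x) <= x]. *)
Lemma power_tail_step e n : 0 < e -> (0 < n)%N ->
  e * expR (- ((1 + e) * ln n.+1%:R)) <=
  expR (- (e * ln n%:R)) - expR (- (e * ln n.+1%:R)).
Proof.
move=> e0 n0; have n0' : 0 < n%:R :> R by rewrite ltr0n.
have -> : - ((1 + e) * ln n.+1%:R) = - (e * ln n.+1%:R) - ln n.+1%:R :> R by ring.
rewrite expRD (expRN (ln _)) lnK ?posrE ?ltr0n//.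
have step : n.+1%:R^-1 <= ln n.+1%:R - ln n%:R :> R.
  rewrite -[leRHS]opprB lerNr -ln_div ?posrE ?ltr0n//.
  have -> : n%:R / n.+1%:R = 1 + - n.+1%:R^-1 :> R.
    by rewrite -[in RHS](@divff _ n.+1%:R) ?pnatr_eq0// -natr1; field; rewrite natr1 pnatr_eq0.
  by apply: le_ln1Dx; rewrite ltrN2 invf_lt1 ?ltr0n// ltr1n.
have -> : - (e * ln n%:R) = - (e * ln n.+1%:R) + e * (ln n.+1%:R - ln n%:R) by ring.
rewrite expRD mulrCA -[X in _ <= _ - X]mulr1 -mulrBr ler_wpM2l ?expR_ge0//.
rewrite lerBrDl (le_trans _ (expR_ge1Dx _))// lerD2l ler_wpM2l// ltW//.
Qed.

Lemma power_sum_le e N n : 0 < e -> (0 < N)%N ->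
  \sum_(N <= i < n) expR (- ((1 + e) * ln i.+1%:R)) <= e^-1.
Proof.
move=> e0 N0; rewrite -[leRHS]mul1r ler_pdivlMr// mulrC mulr_sumr.
have [nN|Nn] := leqP n N; first by rewrite big_geq.
apply: (@le_trans _ _ (expR (- (e * ln N%:R)) - expR (- (e * ln n%:R)))).
  rewrite -[leRHS]opprB -(telescope_sumr (fun i => expR (- (e * ln i%:R))) (ltnW Nn)) -sumrN.
  rewrite !big_nat; apply: ler_sum => i /andP[Ni _].
  by rewrite opprB power_tail_step// (leq_trans N0).
rewrite (@le_trans _ _ (expR (- (e * ln N%:R))))// ?gerBl ?expR_ge0//.
by rewrite -[leRHS]expR0 ler_expR oppr_le0 mulr_ge0 ?(ltW e0)// ln_ge0// ler1n.
Qed.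

(* [2^n] increments, each with exponent growing like [(9/8)^n >= 1 + n/8]. *)
Lemma level_tail_le y n : 32 <= y ->
  (2 ^+ n) * expR (- (y * (9 / 8) ^+ n)) <= expR (- y) * (1 / 2) ^+ n :> R.
Proof.
move=> y32.
have h98 : 1 + n%:R / 8 <= (9 / 8) ^+ n :> R.
  elim: n => [|n ih]; first by rewrite expr0 mul0r addr0.
  have n0 : 0 <= n%:R :> R by rewrite ler0n.
  rewrite exprS -natr1; nra.
(* As [32 / 8 = 4], the surplus [y * n / 8] in the exponent is at least [4 * n]; this beats
   [4 ^+ n], which pays for the [2 ^+ n] increments and leaves a geometric factor. *)
have e4 : 4 ^+ n <= expR (n%:R * 4) :> R.
  rewrite expRM_natl lerXn2r ?nnegrE ?expR_ge0//.
  by rewrite (le_trans _ (expR_ge1Dx _))//; lra.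
have -> : (2 : R) ^+ n = 4 ^+ n * (1 / 2) ^+ n by rewrite -exprMn; congr (_ ^+ _); field.
rewrite mulrAC ler_wpM2r ?exprn_ge0//.
apply: (@le_trans _ _ (expR (n%:R * 4) * expR (- (y * (9 / 8) ^+ n)))).
  by rewrite ler_wpM2r ?expR_ge0.
have n0 : 0 <= n%:R :> R by rewrite ler0n.
by rewrite -expRD ler_expR; nra.
Qed.

Lemma geometric_half_le n : \sum_(i < n) (1 / 2) ^+ i <= 2 :> R.
Proof.
suff -> : \sum_(i < n) (1 / 2) ^+ i = 2 - 2 * (1 / 2) ^+ n :> R.
  by rewrite gerBl mulr_ge0// exprn_ge0.
elim: n => [|n ih]; first by rewrite big_ord0 expr0; lra.
by rewrite big_ord_recr/= ih exprS; field.
Qed.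

End power_sums.

Section chaining_tail.
Context {R : realType} {d : measure_display} {Omega : measurableType d}.
Variables (P : probability Omega R) (W : R -> {RV P >-> R}).
Hypothesis W_wiener : standard_wiener W.

(** The ratio 3/4 lies between [1 / sqrt 2] and 1. The thresholds are thus summable, and yet they
    grow relative to the standard deviation, which shrinks by [1 / sqrt 2] per level:
    [2 * (3 / 4)^2 = 9 / 8]. *)
Definition bad_increment (a b y : R) (n k : nat) : set Omega :=
  [set w | y * (3 / 4) ^+ n <= W (dyadic a b n k.+1) w - W (dyadic a b n k) w].

Definition bad_block (a b y : R) : set Omega :=
  \bigcup_n \big[setU/set0]_(k < 2 ^ n) bad_increment a b y n k.

Lemma measurable_bad_level a b y n :
  measurable (\big[setU/set0]_(k < 2 ^ n) bad_increment a b y n k).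
Proof. by apply: bigsetU_measurable => k _; exact: measurable_increment_ge. Qed.

Lemma measurable_bad_block a b y : measurable (bad_block a b y).
Proof. by apply: bigcup_measurable => n _; exact: measurable_bad_level. Qed.

Lemma bad_increment_tail (a b x : R) n k : 0 <= a -> a < b -> 0 <= x ->
  (P (bad_increment a b (x * Num.sqrt (b - a)) n k) <=
   (expR (- (x ^+ 2 / 2 * (9 / 8) ^+ n)))%:E)%E.
Proof.
move=> a0 ab x0; have ba0 : 0 < b - a by rewrite subr_gt0.
have p2 : 0 < 2 ^+ n :> R by rewrite exprn_gt0.
have dk : dyadic a b n k.+1 - dyadic a b n k = (b - a) / 2 ^+ n.
  by rewrite /dyadic -natr1; ring.
have s0 : 0 <= dyadic a b n k.
  by rewrite addr_ge0// mulr_ge0 ?(ltW ba0)// divr_ge0// ltW.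
have st : dyadic a b n k < dyadic a b n k.+1 by rewrite -subr_gt0 dk divr_gt0.
have x'0 : 0 <= x * (3 / 4) ^+ n * Num.sqrt (2 ^+ n).
  by rewrite !mulr_ge0// exprn_ge0.
have := wiener_upper_tail_le W_wiener s0 st x'0.
rewrite dk.
have -> : x * (3 / 4) ^+ n * Num.sqrt (2 ^+ n) * Num.sqrt ((b - a) / 2 ^+ n) =
    x * Num.sqrt (b - a) * (3 / 4) ^+ n.
  rewrite -[LHS]mulrA -sqrtrM ?(ltW p2)//.
  by rewrite [2 ^+ n * _]mulrC divfK ?gt_eqF//; ring.
have -> : - (x * (3 / 4) ^+ n * Num.sqrt (2 ^+ n)) ^+ 2 / 2 =
    - (x ^+ 2 / 2 * (9 / 8) ^+ n).
  have -> : (9 / 8) ^+ n = ((3 / 4) ^+ n) ^+ 2 * 2 ^+ n :> R.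
    by rewrite -exprM mulnC exprM -exprMn; congr (_ ^+ _); field.
  rewrite exprMn sqr_sqrtr ?(ltW p2)// exprMn mulNr; congr (- _).
  by rewrite -mulrA mulrAC.
by [].
Qed.

(** This takes the place of the reflection principle: up to constants, the maximum over a block has
    the tail of a single increment. *)
Lemma bad_block_tail (a b x : R) : 0 <= a -> a < b -> 8 <= x ->
  (P (bad_block a b (x * Num.sqrt (b - a))) <= (2 * expR (- (x ^+ 2 / 2)))%:E)%E.
Proof.
move=> a0 ab x8; have x0 : 0 <= x by lra.
apply: (le_trans (generalized_Boole_inequality _ _ _)).
- by move=> n; exact: measurable_bad_level.
- exact: measurable_bad_block.
apply: lime_le; first exact: is_cvg_nneseries.
apply: nearW => n; rewrite big_mkord.
apply: (@le_trans _ _ (\sum_(i < n) (expR (- (x ^+ 2 / 2)) * (1 / 2) ^+ i)%:E)%E).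
  apply: lee_sum => i _; apply: (le_trans (Boole_inequality _ _)).
    by move=> k _; exact: measurable_increment_ge.
  apply: (@le_trans _ _ (\sum_(k < 2 ^ i) (expR (- (x ^+ 2 / 2 * (9 / 8) ^+ i)))%:E)%E).
    by apply: lee_sum => k _; exact: bad_increment_tail.
  rewrite sumEFin lee_fin sumr_const card_ord -[X in X <= _]mulr_natl natrX.
  by apply: level_tail_le; nra.
rewrite sumEFin lee_fin -mulr_sumr [leRHS]mulrC ler_wpM2l ?expR_ge0//.
exact: geometric_half_le.
Qed.

End chaining_tail.

(** * Upper half of the law of the iterated logarithm *)

Section lil_upper.
Context {R : realType} {d : measure_display} {Omega : measurableType d}.
Variables (P : probability Omega R) (W : R -> {RV P >-> R}).
Hypothesis W_wiener : standard_wiener W.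

Section ratio.
Variable s : R.
Hypothesis s0 : 0 < s.

(** A block then has standard deviation [s * sqrt (q ^+ n)], so chaining adds only the fraction
    [4 * s] to the bound at its left end. *)
Let q := 1 + s ^+ 2.
(** The Gaussian tail at this level is (n+1)^-(1+s), which is summable. *)
Let x (n : nat) := Num.sqrt (2 * ((1 + s) * ln n.+1%:R)).

Let q1 : 1 < q.
Proof. by rewrite ltrDl exprn_gt0. Qed.

Let qn0 n : 0 < q ^+ n.
Proof. by rewrite exprn_gt0// (lt_trans _ q1). Qed.

Let qnS n : q ^+ n < q ^+ n.+1.
Proof. by rewrite exprS ltr_pMl. Qed.

Let qnB n : Num.sqrt (q ^+ n.+1 - q ^+ n) = s * Num.sqrt (q ^+ n).
Proof.
have -> : q ^+ n.+1 - q ^+ n = s ^+ 2 * q ^+ n by rewrite exprS /q; ring.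
by rewrite sqrtrM ?sqr_ge0// sqrtr_sqr gtr0_norm.
Qed.

Let ln_ge0' n : 0 <= ln n.+1%:R :> R.
Proof. by rewrite ln_ge0// ler1n. Qed.

Let s10 : 0 <= 1 + s.
Proof. by rewrite addr_ge0 ?(ltW s0). Qed.

Let x2 n : x n ^+ 2 / 2 = (1 + s) * ln n.+1%:R.
Proof.
by rewrite sqr_sqrtr ?mulr_ge0//; field.
Qed.

Let bad n : set Omega :=
  [set w | x n * Num.sqrt (q ^+ n) <= W (q ^+ n) w - W 0 w] `|`
  bad_block W (q ^+ n) (q ^+ n.+1) (x n * Num.sqrt (q ^+ n.+1 - q ^+ n)).

(** From here on [x n ^+ 2 / 2 >= 32], that is [8 <= x n], the range of [bad_block_tail]. *)
Let N := (Num.trunc (expR (32 : R))).+1.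

Let N_tail n : (N <= n)%N -> 8 <= x n.
Proof.
move=> Nn; rewrite -[leLHS]gtr0_norm// -sqrtr_sqr ler_sqrt.
  have h : expR (32 : R) <= n.+1%:R.
    apply/ltW/(lt_le_trans (truncnS_gt _)).
    by rewrite ler_nat (leq_trans Nn)// ltnW.
  have : 32 <= ln n.+1%:R :> R by rewrite -[leLHS]expRK ler_ln ?posrE ?expR_gt0.
  by have := s0; nra.
by rewrite mulr_ge0// mulr_ge0//; have := s0; lra.
Qed.

Lemma lil_upper_ratio :
  {ae P, forall w, \forall T \near +oo, W T w <= (1 + s) * (1 + 4 * s) * lil_env T}.
Proof.
have bc : {ae P, forall w, \forall n \near \oo, ~ bad n w}.
  apply: (@borel_cantelli_bounded _ _ _ P bad
    (fun n => 3 * expR (- ((1 + s) * ln n.+1%:R))) N (3 * s^-1)).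
  - move=> n; apply: measurableU; last exact: measurable_bad_block.
    exact: measurable_increment_ge.
  - move=> n Nn; have x8 := N_tail Nn.
    apply: (le_trans (measureU2 _ _ _)).
    + exact: measurable_increment_ge.
    + exact: measurable_bad_block.
    have -> : 3 * expR (- ((1 + s) * ln n.+1%:R)) =
        expR (- (x n ^+ 2 / 2)) + 2 * expR (- (x n ^+ 2 / 2)) :> R.
      by rewrite x2; ring.
    rewrite EFinD leeD//; last by apply: bad_block_tail => //; exact: ltW.
    have := wiener_upper_tail_le W_wiener (lexx 0) (qn0 n) (sqrtr_ge0 (2 * ((1 + s) * ln n.+1%:R))).
    by rewrite subr0 mulNr.
  - by move=> n; rewrite -mulr_sumr ler_wpM2l// power_sum_le.
apply: filterS3 bc (wiener_start W_wiener) (wiener_continuous_paths W_wiener) => w.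
move=> [n0 _ nbad] W0 Wc.
have lq0 : 0 < ln q by rewrite ln_gt0.
(* [K <= ln n] is what turns [ln 2 + ln n] into at most [(1 + s) * (ln n + ln (ln q))], hence into
   at most [(1 + s) * ln (ln T)] when [q ^+ n <= T]. *)
pose K := (ln 2 - (1 + s) * ln (ln q)) / s.
pose n1 := maxn n0 (maxn N (Num.trunc (expR K)).+1).
near=> T.
have qT : q ^+ n1 <= T by near: T; apply: nbhs_pinfty_ge; exact: num_real.
have T0 : 0 < T by rewrite (lt_le_trans _ qT).
have T3 : expR (expR 1) <= T by near: T; apply: nbhs_pinfty_ge; exact: num_real.
have [l1 l2 l3] := lnlnT_ge1 T3.
have ex : exists m, T < q ^+ m.
  pose m := (Num.trunc (ln T / ln q)).+1; exists m.
  rewrite -ltr_ln ?posrE// lnXn ?(lt_trans _ q1)// -[ltRHS]mulr_natl -ltr_pdivrMr//.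
  exact: truncnS_gt.
case: (ex_minnP ex) => -[|n] Tq qmin.
  by move: Tq; rewrite expr0 ltNge l3.
have qnT : q ^+ n <= T.
  by rewrite leNgt; apply/negP => /qmin; rewrite ltnn.
have n1n : (n1 <= n)%N.
  by rewrite -ltnS -(ltr_eXn2l q1) (le_lt_trans qT).
have n0n : (n0 <= n)%N by rewrite (leq_trans _ n1n)// leq_maxl.
have Nn : (N <= n)%N by rewrite (leq_trans _ n1n)// !leq_max leqnn orbT.
have Kn : expR K <= n%:R.
  apply/ltW/(lt_le_trans (truncnS_gt _)).
  by rewrite ler_nat (leq_trans _ n1n)// !leq_max leqnn !orbT.
have /not_orP[nb1 nb2] := nbad n n0n.
have x0 : 0 <= x n by exact: sqrtr_ge0.
have h1 : W (q ^+ n) w <= x n * Num.sqrt (q ^+ n).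
  by rewrite leNgt; apply/negP => h; apply: nb1 => /=; rewrite W0 subr0 ltW.
have h2 : W T w <= W (q ^+ n) w + 4 * (x n * Num.sqrt (q ^+ n.+1 - q ^+ n)).
  apply: (chaining (ltW (qn0 n)) (qnS n) _ Wc); last by rewrite qnT ltW.
    by rewrite mulr_ge0.
  move=> j k jk; rewrite leNgt; apply/negP => h; apply: nb2.
  exists j => //; rewrite -bigcup_mkord; exists k => //=.
  by rewrite /bad_increment/= ltW.
have n00 : (0 < n)%N by exact: leq_trans Nn.
have n0R : 0 < n%:R :> R by rewrite ltr0n.
have h3 : ln n.+1%:R <= (1 + s) * ln (ln T).
  have a1 : ln n.+1%:R <= ln 2 + ln n%:R :> R.
    rewrite -lnM ?posrE// ler_ln ?posrE ?ltr0n// ?mulr_gt0//.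
    by rewrite -natrM ler_nat mul2n -addnn -addn1 leq_add2l.
  have a2 : ln n%:R + ln (ln q) <= ln (ln T).
    rewrite -lnM ?posrE// ler_ln ?posrE ?mulr_gt0// ?(lt_le_trans _ l2)//.
    by rewrite mulr_natl -lnXn ?(lt_trans _ q1)// ler_ln ?posrE.
  have a3 : K <= ln n%:R by rewrite -[leLHS]expRK ler_ln ?posrE ?expR_gt0.
  have a4 : K * s = ln 2 - (1 + s) * ln (ln q) by rewrite /K divfK// gt_eqF.
  have {}a4 : ln 2 - (1 + s) * ln (ln q) <= ln n%:R * s by rewrite -a4 ler_pM2r.
  rewrite (le_trans a1)// (le_trans _ (ler_wpM2l s10 a2))//.
  by rewrite !mulrDl !mul1r; move: a4; rewrite mulrDl mul1r; clear qT Tq qnT T3 Kn; lra.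
have h4 : x n * Num.sqrt (q ^+ n) <= (1 + s) * lil_env T.
  rewrite -[X in X * lil_env T]ger0_norm// -sqrtr_sqr /lil_env /x.
  rewrite -!sqrtrM ?sqr_ge0 ?mulr_ge0//.
  apply: ler_wsqrtr.
  have -> : (1 + s) ^+ 2 * (2 * T * ln (ln T)) = 2 * ((1 + s) * ((1 + s) * ln (ln T))) * T.
    by ring.
  apply: ler_pM => //; rewrite ?mulr_ge0//; first exact: ltW.
  by rewrite ler_pM2l// ler_wpM2l.
have h5 : W T w <= x n * Num.sqrt (q ^+ n) * (1 + 4 * s).
  rewrite (le_trans h2)// qnB mulrDr mulr1 (le_trans (lerD h1 (lexx _)))// lerD2l.
  by rewrite (_ : 4 * _ = x n * Num.sqrt (q ^+ n) * (4 * s))//; ring.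
rewrite (le_trans h5)// -[leRHS]mulrAC ler_wpM2r// addr_ge0 ?mulr_ge0// ltW.
Unshelve. all: by end_near. Qed.

End ratio.

Lemma lil_upper (e : R) : 0 < e ->
  {ae P, forall w, \forall T \near +oo, W T w <= (1 + e) * lil_env T}.
Proof.
(* For [s <= 1], [(1 + s) * (1 + 4 * s) <= 1 + 9 * s]. *)
move=> e0; pose s := Num.min 1 e / 9.
have m0 : 0 < Num.min 1 e by rewrite lt_min ltr01.
have m1 : Num.min 1 e <= 1 by rewrite ge_min lexx.
have me : Num.min 1 e <= e by rewrite ge_min lexx orbT.
have s0 : 0 < s by rewrite divr_gt0.
have s1 : s <= 1 by rewrite /s; lra.
have := lil_upper_ratio s0; apply: filterS => w; apply: filterS => T h.
rewrite (le_trans h)// ler_wpM2r ?sqrtr_ge0//.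
have s9 : 9 * s <= e by rewrite /s; lra.
by nra.
Qed.

End lil_upper.

(** * Lower half of the law of the iterated logarithm *)

Section lil_lower.
Context {R : realType} {d : measure_display} {Omega : measurableType d}.
Variables (P : probability Omega R) (W : R -> {RV P >-> R}).
Hypothesis W_wiener : standard_wiener W.

Section ratio.
Variable s : R.
Hypotheses (s0 : 0 < s) (s5 : s <= 1 / 5).

(** The ratio is large here, so that [sqrt (q ^+ n)] is only the fraction [s] of [sqrt (q ^+ n.+1)]
    and the earlier position hardly matters. *)
Let q := s^-1 ^+ 2.
(** The lower Gaussian tail bound at [y n - 1] is exactly [normal_peak 1 / n.+1], a harmonic
    term. *)
Let y (n : nat) : R := Num.sqrt (2 * ln n.+1%:R).

Let sV : 5 <= s^-1.
Proof. by rewrite -[leLHS]invrK lef_pV2 ?posrE// -[leRHS]mul1r. Qed.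

Let q2 : 2 <= q.
Proof. by rewrite /q; have := sV; nra. Qed.

Let q0 : 0 < q.
Proof. by rewrite (lt_le_trans _ q2). Qed.

Let q1 : 1 < q.
Proof. by rewrite (lt_le_trans _ q2)// ltr1n. Qed.

Let qn0 n : 0 < q ^+ n.
Proof. by rewrite exprn_gt0. Qed.

Let qnS n : q ^+ n < q ^+ n.+1.
Proof. by rewrite exprS ltr_pMl. Qed.

Let sq n : Num.sqrt (q ^+ n) = s * Num.sqrt (q ^+ n.+1).
Proof.
rewrite exprS sqrtrM ?(ltW q0)// /q sqrtr_sqr ger0_norm ?invr_ge0 ?(ltW s0)//.
by rewrite mulrA divff ?mul1r// gt_eqF.
Qed.

Let qnB n : (1 - s) * Num.sqrt (q ^+ n.+1) <= Num.sqrt (q ^+ n.+1 - q ^+ n).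
Proof.
have h : 0 <= 1 - s by rewrite subr_ge0 (le_trans s5)//; lra.
rewrite -[X in X * _](ger0_norm h) -sqrtr_sqr -sqrtrM ?sqr_ge0// ler_wsqrtr//.
have -> : q ^+ n.+1 - q ^+ n = (1 - s ^+ 2) * q ^+ n.+1.
  by rewrite [q ^+ n.+1]exprS /q; field; rewrite gt_eqF.
by rewrite ler_wpM2r ?ltW//; have := s0; have := s5; nra.
Qed.

Let ln_ge0' n : 0 <= ln n.+1%:R :> R.
Proof. by rewrite ln_ge0// ler1n. Qed.

(** The first summand ensures [s^-1 <= y n], the second [ln (ln q) <= s * ln n.+1]. *)
Let K := 2 * (s^-1 ^+ 2) + `|ln (ln q)| / s.
Let N := (Num.trunc (expR K)).+1.

Let N_le n : (N <= n)%N -> K <= ln n.+1%:R :> R.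
Proof.
move=> Nn; rewrite -[leLHS]expRK ler_ln ?posrE ?expR_gt0//.
apply/ltW/(lt_le_trans (truncnS_gt _)).
by rewrite ler_nat (leq_trans Nn).
Qed.

Let y_ge n : (N <= n)%N -> s^-1 <= y n.
Proof.
move=> /N_le Kn; have sV0 : 0 <= s^-1 by rewrite (le_trans _ sV).
rewrite -[leLHS](ger0_norm sV0) -sqrtr_sqr ler_wsqrtr//.
have : 0 <= `|ln (ln q)| / s by rewrite divr_ge0// ltW.
have : 0 <= s^-1 ^+ 2 by rewrite sqr_ge0.
by move: Kn; rewrite /K; lra.
Qed.

Let y_ge1 n : (N <= n)%N -> 1 <= y n.
Proof. by move=> /y_ge; apply: le_trans; rewrite (le_trans _ sV)// ler1n. Qed.

Let X n w := W (q ^+ n.+1) w - W (q ^+ n) w.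
Let A n : set R := `[(y n - 1) * Num.sqrt (q ^+ n.+1 - q ^+ n), +oo[%classic.

Let large_increments :
  {ae P, forall w, forall M, exists2 n, (M <= n)%N & A n (X n w)}.
Proof.
apply: (@independent_borel_cantelli _ _ _ P X A (normal_peak 1) N).
- by move=> i; exact: measurable_increment.
- by move=> i; exact: measurable_itv.
- move=> n; apply: (wiener_independent_increments W_wiener).
    by rewrite expr0.
  by move=> i j ij; rewrite ler_weXn2l// ltW.
- by rewrite normal_peak_gt0.
- move=> n Nn; have y1 : 0 <= y n - 1 by rewrite subr_ge0 y_ge1.
  have := wiener_upper_tail_ge W_wiener (ltW (qn0 n)) (qnS n) y1.
  rewrite subrK mulNr /y sqr_sqrtr ?mulr_ge0// mulrAC divff// mul1r expRN lnK ?posrE ?ltr0n//.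
  move=> /le_trans; apply; rewrite le_eqVlt; apply/orP; left; apply/eqP.
  by congr (P _); apply/seteqP; split => w /=; rewrite /A /X /= in_itv/= andbT.
Qed.

(** The factor [sqrt 2] doubles the exponent, so the tails are summable like (n+1)^-2. *)
Let small_positions :
  {ae P, forall w, \forall n \near \oo,
    ~ (W (q ^+ n) w - W 0 w <= - (Num.sqrt 2 * y n * Num.sqrt (q ^+ n)))}.
Proof.
apply: (@borel_cantelli_bounded _ _ _ P
  (fun n => [set w | W (q ^+ n) w - W 0 w <= - (Num.sqrt 2 * y n * Num.sqrt (q ^+ n))])
  (fun n => expR (- ((1 + 1) * ln n.+1%:R))) 1 1^-1).
- by move=> n; exact: measurable_increment_le.
- move=> n _; have y0 : 0 <= Num.sqrt 2 * y n by rewrite mulr_ge0 ?sqrtr_ge0.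
  have := wiener_lower_tail_le W_wiener (lexx 0) (qn0 n) y0; rewrite subr0.
  have -> : - (Num.sqrt 2 * y n) ^+ 2 / 2 = - ((1 + 1) * ln n.+1%:R) :> R.
    rewrite (exprMn _ (Num.sqrt 2)) sqr_sqrtr// [y n ^+ 2]sqr_sqrtr ?mulr_ge0//.
    by field.
  by [].
- by move=> n; apply: power_sum_le.
Qed.

(** The 5 counts losses of relative size [s]: one from the variance of the increment, one from the
    unit in [y n - 1] (as [1 <= s * y n]), two from the position at [q ^+ n], one from comparing
    [y n] with the envelope. *)
Lemma lil_lower_ratio :
  {ae P, forall w, forall M, exists2 T, M < T & (1 - 5 * s) * lil_env T <= W T w}.
Proof.
apply: filterS3 large_increments small_positions (wiener_start W_wiener) => w.
move=> Xw [n0 _ nsmall] W0 M.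
have [n] := Xw (maxn n0 (maxn N (Num.trunc M).+1)).
rewrite !geq_max => /and3P[n0n Nn Mn]; rewrite /A/= in_itv/= andbT => Xn.
have Mq : M < q ^+ n.+1.
  apply: (@lt_le_trans _ _ (Num.trunc M).+1%:R); first exact: truncnS_gt.
  apply: (@le_trans _ _ (2 ^+ n.+1)).
    by rewrite -natrX ler_nat (leq_trans Mn)// (leq_trans (leqnSn n))// ltnW// ltn_expl.
  by rewrite lerXn2r ?nnegrE// ltW.
exists (q ^+ n.+1) => //.
have := nsmall n n0n; rewrite /= W0 subr0 => /negP; rewrite -ltNge => lown.
have sy := y_ge Nn; have Kn := N_le Nn.
have y0 : 0 <= y n by exact: sqrtr_ge0.
have lq0 : 0 < ln q by rewrite ln_gt0.
have lnln : ln (ln (q ^+ n.+1)) = ln n.+1%:R + ln (ln q).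
  by rewrite lnXn// -[ln q *+ _]mulr_natl lnM ?posrE ?ltr0n.
have env : lil_env (q ^+ n.+1) <= (1 + s) * y n * Num.sqrt (q ^+ n.+1).
  have s10 : 0 <= 1 + s by rewrite addr_ge0// ltW.
  rewrite -[X in X * y n](ger0_norm s10) -sqrtr_sqr -!sqrtrM ?mulr_ge0 ?sqr_ge0//.
  apply: ler_wsqrtr; rewrite -[leLHS]mulrA [_ * ln (ln _)]mulrC mulrA ler_wpM2r ?(ltW (qn0 _))//.
  rewrite mulrCA ler_wpM2l// lnln.
  have h1 : ln (ln q) <= s * ln n.+1%:R.
    rewrite (le_trans (ler_norm _))// mulrC -ler_pdivrMr// (le_trans _ Kn)//.
    by rewrite lerDr mulr_ge0// sqr_ge0.
  have h2 : 0 <= s * ln n.+1%:R by rewrite mulr_ge0// ltW.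
  have h3 : 0 <= s ^+ 2 * ln n.+1%:R by rewrite mulr_ge0// sqr_ge0.
  rewrite (_ : (1 + s) ^+ 2 * ln n.+1%:R =
    ln n.+1%:R + s * ln n.+1%:R + s * ln n.+1%:R + s ^+ 2 * ln n.+1%:R); last by ring.
  by rewrite (le_trans (lerD (lexx _) h1))// -addrA lerDl addr_ge0.
have s2 : Num.sqrt 2 <= 2 :> R.
  by rewrite -[leRHS]ger0_norm// -sqrtr_sqr ler_wsqrtr// expr2; lra.
set r := Num.sqrt (q ^+ n.+1) in env *.
have r0 : 0 <= r by exact: sqrtr_ge0.
have h1 : (y n - 1) * ((1 - s) * r) <= X n w.
  by rewrite (le_trans _ Xn)// ler_wpM2l ?qnB// subr_ge0 y_ge1.
have h2 : - (2 * y n * (s * r)) <= W (q ^+ n) w.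
  rewrite (le_trans _ (ltW lown))// lerN2 sq ler_wpM2r ?mulr_ge0 ?(ltW s0)//.
  by rewrite ler_wpM2r.
have h3 : (1 - 5 * s) * lil_env (q ^+ n.+1) <= (1 - 5 * s) * ((1 + s) * y n * r).
  by rewrite ler_wpM2l// subr_ge0 -ler_pdivlMl// mulrC.
have h4 : W (q ^+ n.+1) w = X n w + W (q ^+ n) w by rewrite /X subrK.
have sy1 : 1 <= s * y n by rewrite -ler_pdivrMl// mulr1.
apply: (le_trans h3); rewrite h4 (le_trans _ (lerD h1 h2))// -subr_ge0.
have -> : (y n - 1) * ((1 - s) * r) - 2 * y n * (s * r) - (1 - 5 * s) * ((1 + s) * y n * r) =
  r * ((s * y n - 1) + s + 5 * s * (s * y n)) by ring.
by rewrite mulr_ge0// addr_ge0 ?mulr_ge0 ?(ltW s0)// addr_ge0 ?subr_ge0 ?(ltW s0).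
Qed.

End ratio.

Lemma lil_lower (e : R) : 0 < e ->
  {ae P, forall w, forall M, exists2 T, M < T & (1 - e) * lil_env T <= W T w}.
Proof.
move=> e0; pose s := Num.min 1 e / 5.
have m0 : 0 < Num.min 1 e by rewrite lt_min ltr01.
have m1 : Num.min 1 e <= 1 by rewrite ge_min lexx.
have me : Num.min 1 e <= e by rewrite ge_min lexx orbT.
have s0 : 0 < s by rewrite divr_gt0.
have s5 : s <= 1 / 5 by rewrite ler_pM2r ?invr_gt0.
have := lil_lower_ratio s0 s5; apply: filterS => w h M.
have [T MT hT] := h M; exists T => //; apply: le_trans hT.
by rewrite ler_wpM2r ?sqrtr_ge0// lerB// mulrC divfK.
Qed.

End lil_lower.

(** * The theorem *)

Section limsup_pinfty.
Context {R : realType}.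
Implicit Types (f : R -> \bar R) (a : R).

Lemma limf_esup_pinfty_le f a : (forall c, a < c -> \forall T \near +oo, (f T <= c%:E)%E) ->
  (limf_esup f (pinfty_nbhs R) <= a%:E)%E.
Proof.
move=> fa; apply/lee_addgt0Pr => e e0; rewrite -EFinD.
have ae : a < a + e by rewrite ltrDl.
apply: le_trans (ereal_inf_lbound _) _; first by eexists; [exact: (fa _ ae)|reflexivity].
by apply: ge_ereal_sup => _ [T VT <-].
Qed.

Lemma limf_esup_pinfty_ge f a :
  (forall c M : R, c < a -> exists2 T, M < T & (c%:E <= f T)%E) ->
  (a%:E <= limf_esup f (pinfty_nbhs R))%E.
Proof.
move=> fa; apply: le_ereal_inf_tmp => _ [V [M [_ MV]] <-].
apply/lee_addgt0Pr => e e0.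
have [T MT cT] := fa (a - e) M (ltac:(by rewrite gtrBl)).
rewrite -leeBlDr// -EFinB (le_trans cT)//; apply: ereal_sup_ubound.
by exists T => //; exact: MV.
Qed.

End limsup_pinfty.

(** Monotonicity in [e] reduces an uncountable family of almost sure events to [e = 1 / (k + 1)]. *)
Lemma ae_forall_gt0 {R : realType} {d : measure_display} {Omega : measurableType d}
    (P : probability Omega R) (Q : R -> Omega -> Prop) :
  (forall e e' w, e <= e' -> Q e w -> Q e' w) ->
  (forall e, 0 < e -> {ae P, forall w, Q e w}) ->
  {ae P, forall w, forall e, 0 < e -> Q e w}.
Proof.
move=> Qmono Qe.
have : {ae P, forall w, forall k : nat, Q k.+1%:R^-1 w}.
  by apply/ae_foralln => k; apply: Qe; rewrite invr_gt0 ltr0n.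
apply: filterS => w Qw e e0.
apply: (Qmono (Num.trunc e^-1).+1%:R^-1); last exact: Qw.
rewrite -[leRHS]invrK lef_pV2 ?posrE ?invr_gt0 ?ltr0n//.
exact/ltW/truncnS_gt.
Qed.

Theorem theorem6 (R : realType) (d : measure_display)
    (Omega : measurableType d) (P : probability Omega R)
    (W : R -> {RV P >-> R}) (W_wiener : standard_wiener W)
    (psi theta c eps : R -> R) (kappa : R)
    (psi_ge0 : forall u : R, 0 <= psi u)
    (psi_convex : convex_function [set: R^o] (psi : R^o -> R^o))
    (kappa_bounds : 1 <= kappa < 2)
    (psi_eq : forall u : R, 0 < u -> psi u = u `^ kappa * theta u)
    (theta_sv : slowly_varying_at0 theta)
    (theta_karamata : karamata_representation theta c eps)
    (eps_lower : exists2 alpha : R, 0 < alpha < 1 &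
       \forall v \near 0^'+, - (`|ln v| `^ alpha)^-1 < eps v) :
  forall r : R, 0 < r ->
    {ae P, forall w : Omega,
      let L := limf_esup
        (fun T : R => min_energy psi (fun t => W t w) T r
                      * ((T * psi (Num.sqrt (ln (ln T) / T)))^-1)%:E)%E
        (pinfty_nbhs R) in
      ((2 `^ (- (kappa / 2)) / (1 - kappa / 2))%:E >= L)%E /\
      (L >= (2 `^ (kappa / 2))%:E)%E}.
Proof.
move=> r r0.
have upper : {ae P, forall w, forall e, 0 < e ->
    \forall T \near +oo, W T w <= (1 + e) * lil_env T}.
  apply: ae_forall_gt0 => [e e' w ee'|e e0]; last exact: lil_upper.
  by apply: filterS => T /le_trans; apply; rewrite ler_wpM2r ?sqrtr_ge0// lerD2l.
have lower : {ae P, forall w, forall e, 0 < e ->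
    forall M, exists2 T, M < T & (1 - e) * lil_env T <= W T w}.
  apply: ae_forall_gt0 => [e e' w ee' h M|e e0]; last exact: lil_lower.
  have [T MT hT] := h M; exists T => //; apply: le_trans hT.
  by rewrite ler_wpM2r ?sqrtr_ge0// lerB.
have path : {ae P, forall w, W 0 w = 0 /\ {within `[0, +oo[, continuous (fun t => W t w)}}.
  by apply: filterS2 (wiener_start W_wiener) (wiener_continuous_paths W_wiener) => w.
apply: filterS3 upper lower path => w up low [W0 Wc] /=; split.
  apply: limf_esup_pinfty_le => c' c'U.
  exact: (normalized_min_energy_le psi_ge0 psi_convex kappa_bounds psi_eq theta_sv
    r0 c'U W0 Wc up).
apply: limf_esup_pinfty_ge => c' M c'L.
have p0 : 0 < 2 `^ (kappa / 2) :> R by rewrite powR_gt0.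
(* [normalized_min_energy_ge] takes a positive constant, while [c'] may be negative. *)
pose c1 := Num.max c' (2 `^ (kappa / 2) / 2).
have c10 : 0 < c1 by rewrite lt_max divr_gt0// orbT.
have c1L : c1 < 2 `^ (kappa / 2).
  by rewrite gt_max c'L ltr_pdivrMr// ltr_pMr// ltr1n.
have [T MT h] := normalized_min_energy_ge psi_ge0 psi_convex kappa_bounds psi_eq theta_sv
  r c10 c1L (fun e M e0 => low e e0 M) M.
by exists T => //; apply: le_trans h; rewrite lee_fin le_max lexx.
Qed.
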